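(* Let $d=1$ and let $\{X_t\}_{t\ge 0}$ be the one-dimensional critical super-Brownian motion with binary branching mechanism $\psi(u)=u^2$, started from a Poisson random measure on $\mathbb{R}$ whose intensity is the Lebesgue measure; let $\mathbb{P}$ denote its law. Let $R_t:=\sup\{u>0: X_t(B(u))=0\}$, where $B(u)=\{x\in\mathbb{R}:|x|<u\}$ and $\sup\emptyset=0$. Then for any $r\in(0,\infty)$, $$\lim_{t\to\infty}\mathbb{P}\left(\frac{R_t}{t}\geq r\right)=e^{-2r}.$$
   Context: Fix a constant $p>d$ and let $\phi_p(x):=(1+|x|^2)^{-p/2}$ for $x\in\mathbb{R}^d$. Let $M_p$ be the space of locally finite measures $\mu$ on $\mathbb{R}^d$ with $\int_{\mathbb{R}^d}\phi_p(x)\,\mu(dx)<\infty$, with the topology in which $\mu_n\to\mu$ iff $\int f\,d\mu_n\to\int f\,d\mu$ for all $f\in\{g+\alpha\phi_p:\alpha\in\mathbb{R},\ g\in C_c(\mathbb{R}^d)\}$. The $d$-dimensional super-Brownian motion with branching mechanism $\psi(u)=u^2$ and initial value $X_0=\mu\in M_p$ (law $\mathbb{P}_\mu$, expectation $\mathbb{E}_\mu$) is the $M_p$-valued Markov process $\{X_t\}_{t\ge0}$ whose transition probabilities are characterized by $$\mathbb{E}_\mu\left[e^{-\langle X_t,\phi\rangle}\right]=e^{-\int_{\mathbb{R}^d}u(t,x)\,\mu(dx)},\qquad \langle X_t,\phi\rangle:=\int_{\mathbb{R}^d}\phi(x)\,X_t(dx),$$ for every nonnegative continuous $\phi$ with $\sup_x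 \phi(x)/\phi_p(x)<\infty$, where $u$ is the unique positive solution of $$\frac{\partial u(t,x)}{\partial t}=\frac12\Delta u(t,x)-u^2(t,x),\qquad u(0,x)=\phi(x).$$ $\mathrm{PRM}(\lambda)$ is the Poisson random measure on $\mathbb{R}^d$ with intensity the Lebesgue measure $\lambda$, and $\mathbb{P}:=\mathbb{P}_{\mathrm{PRM}(\lambda)}$ is the law of the super-Brownian motion when $X_0$ is distributed as $\mathrm{PRM}(\lambda)$ (so that, given $X_0=\mu$, the process has law $\mathbb{P}_\mu$). *)

(* Defs.v *)
From HB Require Import structures.
From mathcomp Require Import all_boot all_order all_algebra.
From mathcomp Require Import all_classical all_reals all_analysis.
From mathcomp Require Import measurable_realfun.

Set Implicit Arguments.
Unset Strict Implicit.
Unset Printing Implicit Defensive.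

Import Order.TTheory GRing.Theory Num.Theory.
Import numFieldNormedType.Exports.

Local Open Scope classical_set_scope.
Local Open Scope ring_scope.

Definition phi_ {R : realType} (p x : R) : R := (1 + x ^+ 2) `^ (- p / 2).

Definition locally_finite {R : realType}
    (mu : {measure set (measurableTypeR R) -> \bar R}) : Prop :=
  forall K : set R, compact K -> (mu K < +oo)%E.

Record Mp {R : realType} (p : R) : Type := MkMp {
  Mp_measure :> {measure set (measurableTypeR R) -> \bar R} ;
  Mp_locally_finite : locally_finite Mp_measure ;
  Mp_tempered : (\int[Mp_measure]_x (phi_ p x)%:E < +oo)%E }.

Section state_space.
Context {R : realType} (p : R).

Let zero_locally_finite :
  locally_finite (mzero : {measure set (measurableTypeR R) -> \bar R}).
Proof. by move=> K _ /=; rewrite /mzero ltry. Qed.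

Let zero_tempered :
  (\int[(mzero : {measure set (measurableTypeR R) -> \bar R})]_x
     (phi_ p x)%:E < +oo)%E.
Proof. by rewrite integral_measure_zero ltry. Qed.

HB.instance Definition _ := gen_eqMixin (Mp p).
HB.instance Definition _ := gen_choiceMixin (Mp p).
HB.instance Definition _ :=
  isPointed.Build (Mp p) (MkMp zero_locally_finite zero_tempered).

Definition Cc : set (R -> R) :=
  [set g : R -> R | continuous g /\ compact (closure [set x | g x != 0])].

Definition Mp_test : set (R -> R) :=
  [set f | exists2 g, Cc g & exists a : R, f = (fun x => g x + a * phi_ p x)].

Definition Mp_eval (mu : Mp p) : {ptws Mp_test -> R} :=
  fun f => (\int[mu]_x (\val f x))%R.

(* The initial topology of [Mp_eval]: [mu_n --> mu] iff the integrals of every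
   function of [Mp_test] converge. *)
HB.instance Definition _ := Topological.copy (Mp p) (initial_topology Mp_eval).

(* The Borel sigma-algebra. *)
HB.instance Definition _ :=
  Measurable.copy (Mp p) (g_sigma_algebraType (@open (Mp p))).

End state_space.

Section super_brownian_motion.
Context {R : realType} (p : R).

Definition laplace_test : set (R -> R) :=
  [set phi : R -> R | [/\ forall x : R, 0 <= phi x, continuous phi &
    has_ubound (range (fun x => phi x / phi_ p x))]].

Definition dt (u : R -> R -> R) (t x : R) : R := derive1 (u^~ x) t.
Definition dx (u : R -> R -> R) (t x : R) : R := derive1 (u t) x.

(* Classical nonnegative solutions on [0, +oo[ x R; the values of [u] at
   negative times are irrelevant. *)
Definition positive_solution (phi : R -> R) (u : R -> R -> R) : Prop :=
  [/\ forall t x : R, 0 <= t -> 0 <= u t x,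
      forall x : R, u 0 x = phi x,
      {within [set z : R * R | 0 <= z.1], continuous (fun z => u z.1 z.2)},
      forall t x : R, 0 < t ->
        [/\ derivable (u^~ x) t 1, derivable (u t) x 1
          & derivable (dx u t) x 1] /\
        [/\ {for (t, x), continuous (fun z => dt u z.1 z.2)},
            {for (t, x), continuous (fun z => dx u z.1 z.2)}
          & {for (t, x), continuous (fun z => dx (dx u) z.1 z.2)}]
    & forall t x : R, 0 < t ->
        dt u t x = 1 / 2 * dx (dx u) t x - u t x ^+ 2].

Definition unique_positive_solution (phi : R -> R) (u : R -> R -> R) : Prop :=
  positive_solution phi u /\
  forall v, positive_solution phi v -> forall t x : R, 0 <= t -> v t x = u t x.

(* [Q t mu] is the law of [X_t] under [P_mu], for [t >= 0]. *)
Definition super_brownian_transition (Q : R -> R.-pker Mp p ~> Mp p) : Prop :=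
  forall phi, laplace_test phi ->
    exists2 u, unique_positive_solution phi u &
      forall (t : R) (mu : Mp p), 0 <= t ->
        (\int[Q t mu]_nu expeR (- \int[(nu : Mp p)]_x (phi x)%:E) =
         expeR (- \int[mu]_x (u t x)%:E))%E.

Context {d : measure_display} {Omega : measurableType d}
  (P : probability Omega R).

Definition past (X : R -> Omega -> Mp p) (s : R) : set (set Omega) :=
  <<s [set A | exists (q : R) (B : set (Mp p)),
         [/\ 0 <= q <= s, measurable B & A = X q @^-1` B]] >>.

(* [P (X_(s + t) \in B | past X s) = Q t (X s) B], with the conditional
   probability expressed by its defining integral identity. *)
Definition markov_process (Q : R -> R.-pker Mp p ~> Mp p)
    (X : R -> Omega -> Mp p) : Prop :=
  (forall t : R, 0 <= t -> measurable_fun setT (X t)) /\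
  forall (s t : R) A (B : set (Mp p)), 0 <= s -> 0 <= t ->
    past X s A -> measurable B ->
    (P (A `&` X (s + t)%R @^-1` B) = \int[P]_(w in A) Q t (X s w) B)%E.

Definition super_brownian_motion (X : R -> Omega -> Mp p) : Prop :=
  exists2 Q, super_brownian_transition Q & markov_process Q X.

(* The Poisson weights are written out since [poisson_pmf 0 k] is 1 for every
   [k]; here a null set [A] gets [0 ^+ k / k`!], that is, 1 if [k = 0] and 0
   otherwise. *)
Definition poisson_random_measure
    (lambda : {measure set (measurableTypeR R) -> \bar R})
    (xi : Omega -> Mp p) : Prop :=
  [/\ measurable_fun setT xi,
      forall A : set (measurableTypeR R), measurable A ->
        (lambda A < +oo)%E -> forall k : nat,
        P [set w | xi w A = (k%:R)%:E] =
          (expR (- fine (lambda A)) * fine (lambda A) ^+ k / k`!%:R)%:E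
    & forall n (A : 'I_n -> set (measurableTypeR R)) (B : 'I_n -> set (\bar R)),
        (forall i, measurable (A i)) -> trivIset setT A ->
        (forall i, measurable (B i)) ->
        P [set w | forall i, B i (xi w (A i))] =
          (\prod_(i < n) P [set w | B i (xi w (A i))])%E].

End super_brownian_motion.

(* Adding [0] to the set implements the convention [sup set0 = 0]. The supremum
   is taken in [\bar R], as it is [+oo] when [mu] is the zero measure. *)
Definition empty_radius {R : realType} {p : R} (mu : Mp p) : \bar R :=
  ereal_sup (0%E |`
    [set u%:E | u in [set u : R | 0 < u /\ mu [set x | `|x| < u] = 0%E]]).

(* Main.v *)
Require Import Defs.
From HB Require Import structures.
From mathcomp Require Import all_boot all_order all_algebra.
From mathcomp Require Import all_classical all_reals all_analysis.
From mathcomp Require Import measurable_realfun.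
From mathcomp Require Import ring lra.

Set Implicit Arguments.
Unset Strict Implicit.
Unset Printing Implicit Defensive.

Import Order.TTheory GRing.Theory Num.Theory.
Import numFieldNormedType.Exports.

Local Open Scope classical_set_scope.
Local Open Scope ring_scope.

(** Write [obal s] for the open ball of radius [s] and [rho = r * t]. The event
    is [X_t (obal rho) = 0], and its probability given [X_0 = mu] is the limit
    over [n] of [exp (- \int u_n(t, x) mu(dx))], where [u_n] solves the equation
    with initial value [n * max(0, rho - |x|)].

    As [n] grows, [u_n(t, .)] is close to [1 / t] inside the ball and negligible
    outside. From above, [u_n(t, x) <= min(1 / t, 3 / (|x| - rho) ^ 2)]: both
    bounds come from comparison with supersolutions that blow up at the ends of
    an interval. From below, a subsolution supported on [|y - x| <= l] gives
    [u_n(t, x) >= exp (- 2 t / l ^ 2) / (1 + t)] as soon as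
    [|x| <= rho - 2 l] and [n l >= 1].

    The lower bound on [u_n] and the Laplace transform of a Poisson variable bound
    the probability from above; the upper bound on [u_n] and Jensen's inequality
    bound it from below. With [t = y ^ (-4)] and [l = y ^ (-3)], both bounds tend
    to [exp (- 2 r)] as [y] tends to [0]. *)

(** * Parabolic comparison *)

(** The difference quotients converge to [l], hence end up within [|l|] of it and take its sign. The
    factor [l] covers both signs in one statement. *)
Lemma is_derive_sign_near (R : realType) (f : R -> R) (c l : R) :
  is_derive c 1 f l -> l != 0 ->
  \forall h \near 0^', 0 < l * (h^-1 * (f (h + c) - f c)).
Proof.
move=> fl l0.
have cv : h^-1 * (f (h + c) - f c) @[h --> 0^'] --> l.
  have [dfc dfl] := fl.
  rewrite -[X in _ --> X]dfl.
  move: dfc; rewrite /derivable => /cvg_ex[k hk].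
  have -> : 'D_1 f c = k by apply/cvg_lim.
  by under eq_fun do rewrite -[X in f (X + _)]mulr1.
have /cvgrPdist_lt/(_ `|l|) := cv.
rewrite normr_gt0 => /(_ l0); apply: filterS => h /=.
set q := h^-1 * _ => hq.
have [lp|lp|le] := ltgtP l 0.
- rewrite nmulr_rgt0//; move: hq; rewrite (ltr0_norm lp).
  by case: (ler0P (l - q)) => ? ?; lra.
- rewrite pmulr_rgt0//; move: hq; rewrite (gtr0_norm lp).
  by case: (ler0P (l - q)) => ? ?; lra.
- by rewrite le eqxx in l0.
Qed.

(** A positive derivative would put values smaller than [f c] just to the left of [c]. Only the left
    side enters, because a minimum in time may sit at the final time. *)
Lemma is_derive_le0_of_left_min (R : realType) (f : R -> R) (a c l : R) :
  a < c -> (forall s, a < s < c -> f c <= f s) -> is_derive c 1 f l -> l <= 0.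
Proof.
move=> ac fmin fl; rewrite leNgt; apply/negP => l0.
have /(is_derive_sign_near fl) : l != 0 by rewrite gt_eqF.
move=> /nbhs_ballP[e /= e0 he].
pose h := - Num.min (e / 2) ((c - a) / 2).
have m0 : 0 < Num.min (e / 2) ((c - a) / 2).
  by rewrite lt_min !divr_gt0 ?subr_gt0.
have h0 : h < 0 by rewrite /h oppr_lt0.
have he2 : - h <= e / 2 by rewrite /h opprK ge_min lexx.
have hc2 : - h <= (c - a) / 2 by rewrite /h opprK ge_min lexx orbT.
have := he h; rewrite /ball /= sub0r normrN ltr0_norm// lt_eqF//.
have /[swap] /[apply] /(_ isT) : - h < e by lra.
rewrite pmulr_rgt0// nmulr_rgt0 ?invr_lt0// subr_lt0 ltNge.
by rewrite fmin//; apply/andP; split; lra.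
Qed.

(** At an interior minimum [g c = 0]. If [l < 0], then [g] is negative just to the right of [c], and
    the mean value theorem makes [f] drop below [f c]. *)
Lemma second_derivative_ge0_of_min (R : realType) (f g : R -> R) (a b c l : R) :
  a < c < b -> (forall x, a < x < b -> is_derive x 1 f (g x)) ->
  (forall x, a < x < b -> f c <= f x) -> is_derive c 1 g l -> 0 <= l.
Proof.
move=> /andP[ac cb] fg fmin gl; rewrite leNgt; apply/negP => l0.
have gc0 : g c = 0.
  have : is_derive c 1 f 0.
    apply: (@derive1_at_min _ f a b) => [|t|//|t]; first by lra.
    - by rewrite in_itv/= => /fg[].
    - by rewrite in_itv/= ac cb.
    - by rewrite in_itv/= => /fmin.
  by move=> /@derive_val <-; apply/esym/derive_val/fg; rewrite ac cb.
have /(is_derive_sign_near gl) : l != 0 by rewrite lt_eqF.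
move=> /nbhs_ballP[e /= e0 he].
pose h := Num.min (e / 2) ((b - c) / 2).
have h0 : 0 < h by rewrite lt_min !divr_gt0 ?subr_gt0.
have he2 : h <= e / 2 by rewrite /h ge_min lexx.
have hc2 : h <= (b - c) / 2 by rewrite /h ge_min lexx orbT.
have fg' x : x \in `]c, c + h[ -> is_derive x 1 f (g x).
  by rewrite in_itv/= => /andP[? ?]; apply: fg; apply/andP; split; lra.
have [||k] := @MVT _ f g c (c + h) _ fg'; first by lra.
  apply: continuous_in_subspaceT => x; rewrite inE/= in_itv/= => /andP[? ?].
  apply/differentiable_continuous/derivable1_diffP.
  by have [] : is_derive x 1 f (g x) by apply: fg; apply/andP; split; lra.
rewrite in_itv/= => /andP[ck kh] fk.
have : f c <= f (c + h) by apply: fmin; apply/andP; split; lra.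
rewrite -subr_ge0 fk pmulr_lge0; last by lra.
apply/negP; rewrite -ltNge.
have := he (k - c); rewrite /ball /= sub0r normrN gtr0_norm ?subr_gt0//.
rewrite gt_eqF ?subr_gt0// subrK gc0 subr0.
have /[swap] /[apply] /(_ isT) : k - c < e by lra.
by rewrite nmulr_rgt0// pmulr_rlt0 // invr_gt0 subr_gt0.
Qed.

(* A parabolic minimum principle: a point where [w] is minimal and negative
   would satisfy [wt <= 0 <= wxx]. *)
Lemma parabolic_min_ge0 (R : realType) (w wt wx wxx : R -> R -> R)
    (t0 t1 a b : R) :
  {within `[t0, t1] `*` `[a, b], continuous (fun z => w z.1 z.2)} ->
  (forall t x, t0 < t <= t1 -> a < x < b ->
     [/\ is_derive t 1 (w^~ x) (wt t x), is_derive x 1 (w t) (wx t x)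
       & is_derive x 1 (wx t) (wxx t x)]) ->
  (forall t x, t0 < t <= t1 -> a < x < b -> w t x < 0 ->
     1 / 2 * wxx t x < wt t x) ->
  (forall x, a <= x <= b -> 0 <= w t0 x) ->
  (forall t, t0 <= t <= t1 -> 0 <= w t a /\ 0 <= w t b) ->
  forall t x, t0 <= t <= t1 -> a <= x <= b -> 0 <= w t x.
Proof.
move=> cw dw ww w0 wab t x tI xI; rewrite leNgt; apply/negP => wtx.
have K0 : `[t0, t1] `*` `[a, b] !=set0.
  by exists (t, x); split; rewrite /= in_itv.
have cK : compact (`[t0, t1] `*` `[a, b]).
  by apply: compact_setX; exact: segment_compact.
have [[s y]] := compact_EVT_min K0 cK cw.
rewrite inE => -[/=]; rewrite !in_itv/= => sI yI smin.
have {}smin u v : t0 <= u <= t1 -> a <= v <= b -> w s y <= w u v.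
  by move=> uI vI; apply: (smin (u, v)); rewrite inE; split; rewrite /= in_itv.
have wsy : w s y < 0 by rewrite (le_lt_trans _ wtx)// smin.
(* The minimum is negative, whereas [w] is nonnegative at time [t0] and on both lateral sides, so
   [(s, y)] avoids them. It may still lie at time [t1]. *)
have sI' : t0 < s <= t1.
  move: sI => /andP[]; rewrite le_eqVlt => /predU1P[e _|-> ->//].
  by move: wsy; rewrite -e ltNge w0.
have yI' : a < y < b.
  have [wa wb] := wab _ sI.
  move: yI => /andP[]; rewrite le_eqVlt => /predU1P[e|ay].
    by move: wsy; rewrite -e ltNge wa.
  rewrite le_eqVlt => /predU1P[e|->]; last by rewrite ay.
  by move: wsy; rewrite e ltNge wb.
have [ht hx hxx] := dw _ _ sI' yI'.
have : wt s y <= 0.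
  move/andP: sI' => [? ?].
  apply: (@is_derive_le0_of_left_min _ _ t0 s) ht => // u /andP[? ?].
  by apply: smin yI; apply/andP; split; lra.
have : 0 <= wxx s y.
  apply: (@second_derivative_ge0_of_min _ (w s) (wx s) a b y) hxx => //.
    by move=> v vI; have [] := dw _ _ sI' vI.
  by move=> v /andP[? ?]; apply: smin => //; apply/andP; split; lra.
have := ww _ _ sI' yI' wsy; lra.
Qed.

(** * Differentiation rules for explicit formulas *)

Section lambda_derivatives.
Context {R : realType}.
Implicit Types (f g : R -> R) (x a b : R).

(** Splits a computation in two: the rules below assemble a derivative [a] from the shape of the
    formula, and its equality with the expected [b] is left to algebra. *)
Lemma is_derive_congr f g x a b :
  is_derive x 1 f a -> f =1 g -> a = b -> is_derive x 1 g b.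
Proof. by move=> fa /funext <- <-. Qed.

Lemma derivable_is_derive1 f x : derivable f x 1 -> is_derive x 1 f (derive1 f x).
Proof. by move=> fx; rewrite derive1E; exact/derivableP. Qed.

Lemma is_derive_const a x : is_derive x 1 (fun=> a) 0.
Proof. exact: is_derive_cst. Qed.

Lemma is_derive_var x : is_derive x 1 (fun y : R => y) 1.
Proof. exact: is_derive_id. Qed.

Lemma is_derive_funD f g x a b : is_derive x 1 f a -> is_derive x 1 g b ->
  is_derive x 1 (fun y => f y + g y) (a + b).
Proof. exact: is_deriveD. Qed.

Lemma is_derive_funB f g x a b : is_derive x 1 f a -> is_derive x 1 g b ->
  is_derive x 1 (fun y => f y - g y) (a - b).
Proof. exact: is_deriveB. Qed.

Lemma is_derive_funM f g x a b : is_derive x 1 f a -> is_derive x 1 g b ->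
  is_derive x 1 (fun y => f y * g y) (a * g x + f x * b).
Proof.
move=> fa gb; have -> : a * g x + f x * b = f x *: b + g x *: a.
  by rewrite addrC (mulrC a).
exact: is_deriveM.
Qed.

Lemma is_derive_funX f n x a : is_derive x 1 f a ->
  is_derive x 1 (fun y => f y ^+ n) (n%:R * f x ^+ n.-1 * a).
Proof. by move=> fa; have := @is_deriveX _ _ f n x 1 a fa; rewrite exprfctE. Qed.

Lemma is_derive_funV f x a : f x != 0 -> is_derive x 1 f a ->
  is_derive x 1 (fun y => (f y)^-1) (- a / f x ^+ 2).
Proof.
move=> fx0 fa; have := @is_deriveV R f x a 1 fx0 fa.
by rewrite /GRing.scale/= mulNr mulNr mulrC.
Qed.

Lemma is_derive_fun_expR f x a : is_derive x 1 f a ->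
  is_derive x 1 (fun y => expR (f y)) (a * expR (f x)).
Proof.
move=> fa; rewrite mulrC; exact: (@is_derive1_comp R expR f x _ _).
Qed.

Lemma is_derive_continuous f x a : is_derive x 1 f a -> {for x, continuous f}.
Proof. by move=> [fx _]; exact/differentiable_continuous/derivable1_diffP. Qed.

End lambda_derivatives.

Lemma continuous_fst_snd (R : realType) (f g : R -> R) (z : R * R) :
  {for z.1, continuous f} -> {for z.2, continuous g} ->
  {for z, continuous (fun z => f z.1)} /\ {for z, continuous (fun z => g z.2)}.
Proof.
move=> fz gz; split.
- apply: (@continuous_comp _ _ _ fst f); first exact: cvg_fst.
  exact: fz.
- apply: (@continuous_comp _ _ _ snd g); first exact: cvg_snd.
  exact: gz.
Qed.

(** The minimum principle applies to [w = v - u]: where [w < 0], [0 <= v < u] gives [v ^ 2 < u ^ 2],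
    so that [wt - wxx / 2 >= u ^ 2 - v ^ 2 > 0]. *)
Lemma parabolic_comparison (R : realType) (u ut ux uxx v vt vx vxx : R -> R -> R)
    (t0 t1 a b : R) :
  {within `[t0, t1] `*` `[a, b], continuous (fun z => u z.1 z.2)} ->
  {within `[t0, t1] `*` `[a, b], continuous (fun z => v z.1 z.2)} ->
  (forall t x, t0 < t <= t1 -> a < x < b ->
     [/\ is_derive t 1 (u^~ x) (ut t x), is_derive x 1 (u t) (ux t x)
       & is_derive x 1 (ux t) (uxx t x)]) ->
  (forall t x, t0 < t <= t1 -> a < x < b ->
     [/\ is_derive t 1 (v^~ x) (vt t x), is_derive x 1 (v t) (vx t x)
       & is_derive x 1 (vx t) (vxx t x)]) ->
  (forall t x, t0 < t <= t1 -> a < x < b ->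
     [/\ 0 <= v t x, ut t x <= 1 / 2 * uxx t x - u t x ^+ 2
       & 1 / 2 * vxx t x - v t x ^+ 2 <= vt t x]) ->
  (forall x, a <= x <= b -> u t0 x <= v t0 x) ->
  (forall t, t0 <= t <= t1 -> u t a <= v t a /\ u t b <= v t b) ->
  forall t x, t0 <= t <= t1 -> a <= x <= b -> u t x <= v t x.
Proof.
move=> cu cv du dv uv uv0 uvab t x tI xI; rewrite -subr_ge0.
apply: (@parabolic_min_ge0 R (fun t x => v t x - u t x)
  (fun t x => vt t x - ut t x) (fun t x => vx t x - ux t x)
  (fun t x => vxx t x - uxx t x) t0 t1 a b) tI xI.
- by move=> z; apply: continuousB; [exact: cv|exact: cu].
- move=> s y sI yI; have [? ? ?] := du _ _ sI yI; have [? ? ?] := dv _ _ sI yI.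
  by split; apply: is_derive_funB.
- move=> s y sI yI; have [v0 hu hv] := uv _ _ sI yI.
  rewrite subr_lt0 => vu.
  have : v s y ^+ 2 < u s y ^+ 2 by rewrite ltrXn2r.
  lra.
- by move=> y yI; rewrite subr_ge0 uv0.
- by move=> s sI; have [? ?] := uvab _ sI; rewrite !subr_ge0.
Qed.

(** * Bounds on positive solutions *)

Section positive_solution_bounds.
Context {R : realType}.
Variables (phi : R -> R) (u : R -> R -> R).
Hypothesis hu : positive_solution phi u.

Let u_ge0 (t x : R) : 0 <= t -> 0 <= u t x.
Proof. by case: hu => h _ _ _ _; exact: h. Qed.

Let u_continuous : {within [set z : R * R | 0 <= z.1],
  continuous (fun z => u z.1 z.2)}.
Proof. by case: hu => _ _ h _ _; exact: h. Qed.

Let u_continuous_rect (t1 a b : R) :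
  {within `[0, t1] `*` `[a, b], continuous (fun z => u z.1 z.2)}.
Proof.
apply: continuous_subspaceW u_continuous => -[s y] /= [+ _].
by rewrite in_itv/= => /andP[].
Qed.

Let u_derive (t x : R) : 0 < t ->
  [/\ is_derive t 1 (u^~ x) (dt u t x), is_derive x 1 (u t) (dx u t x)
    & is_derive x 1 (dx u t) (dx (dx u) t x)].
Proof.
move=> t0; case: hu => _ _ _ /(_ t x t0)[[d1 d2 d3] _] _.
split.
- exact: (derivable_is_derive1 d1).
- exact: (derivable_is_derive1 d2).
- exact: (derivable_is_derive1 d3).
Qed.

Let u_eq (t x : R) : 0 < t -> dt u t x = 1 / 2 * dx (dx u) t x - u t x ^+ 2.
Proof. by case: hu => _ _ _ _ h; exact: h. Qed.

Lemma positive_solution_continuous (t : R) : 0 < t -> continuous (u t).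
Proof. by move=> t0 x; have [_ + _] := u_derive x t0; exact: is_derive_continuous. Qed.

(* Keller-Osserman: [3 / y ^ 2] is a stationary solution blowing up at [0], and
   a sum of supersolutions is a supersolution, so that no growth condition on
   [u] is needed. *)
Lemma positive_solution_le_barrier (c a b t x : R) :
  0 <= c -> (forall y, a <= y <= b -> phi y <= c) -> 0 < t -> a < x < b ->
  u t x <= c / (1 + c * t) + 3 / (x - a) ^+ 2 + 3 / (b - x) ^+ 2.
Proof.
move=> c0 phic t0 /andP[ax xb].
have [M Mge0 uM] : exists2 M : R, 0 <= M &
    forall s y : R, 0 <= s <= t -> a <= y <= b -> u s y <= M.
  have K0 : `[0, t] `*` `[a, b] !=set0.
    by exists (t, x); split; rewrite /= in_itv/= ?lexx ?(ltW t0) ?(ltW ax) ?ltW.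
  have cK : compact (`[0, t] `*` `[a, b]).
    by apply: compact_setX; exact: segment_compact.
  have [[s y]] := compact_EVT_max K0 cK (@u_continuous_rect _ _ _).
  rewrite inE => -[/=]; rewrite !in_itv/= => sI yI smax.
  exists (u s y); first by apply: u_ge0; case/andP: sI.
  by move=> s' y' ? ?; apply: (smax (s', y')); rewrite inE; split; rewrite /= in_itv.
(* The first two terms keep [x] in [[a + e, b - e]]; the third makes [3 / e ^ 2] at least [M], so
   that the barrier dominates [u] within [e] of each end. *)
pose e := Num.min (Num.min ((x - a) / 2) ((b - x) / 2)) (M + 1)^-1.
have e0 : 0 < e by rewrite !lt_min !divr_gt0 ?invr_gt0 ?subr_gt0 ?ltr_wpDl.
have ea : e <= (x - a) / 2 by rewrite /e !ge_min lexx.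
have eb : e <= (b - x) / 2 by rewrite /e !ge_min lexx orbT.
have eM : M <= 3 / e ^+ 2.
  have : e <= (M + 1)^-1 by rewrite /e !ge_min lexx !orbT.
  have M1 : 0 < M + 1 by rewrite ltr_wpDl.
  rewrite -[X in X <= _]invrK lef_pV2 ?posrE ?invr_gt0// => Me.
  rewrite -exprVn; have : (M + 1) ^+ 2 <= e^-1 ^+ 2.
    by rewrite lerXn2r// ?nnegrE ?ltW ?invr_gt0.
  by nra.
(* [c / (1 + c * s)] solves [h' = - h ^ 2] with [h 0 = c]; the two other terms are the stationary
   solutions blowing up at [a] and [b]. *)
pose v (s y : R) : R := c / (1 + c * s) + 3 / (y - a) ^+ 2 + 3 / (b - y) ^+ 2.
pose vt (s y : R) : R := - (c / (1 + c * s)) ^+ 2.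
pose vx (s y : R) : R := - 6 / (y - a) ^+ 3 + 6 / (b - y) ^+ 3.
pose vxx (s y : R) : R := 18 / (y - a) ^+ 4 + 18 / (b - y) ^+ 4.
have cs0 (s : R) : 0 <= s -> 0 < 1 + c * s by move=> s0; rewrite ltr_wpDr// mulr_ge0.
have vpos (s y : R) : 0 <= s ->
    [/\ 0 <= c / (1 + c * s), 0 <= 3 / (y - a) ^+ 2 & 0 <= 3 / (b - y) ^+ 2].
  by move=> s0; split; rewrite divr_ge0 ?sqr_ge0// ltW// cs0.
have dv (s y : R) : 0 <= s -> a < y < b -> [/\ is_derive s 1 (v^~ y) (vt s y),
    is_derive y 1 (v s) (vx s y) & is_derive y 1 (vx s) (vxx s y)].
  move=> s0 /andP[ay yb]; split.
  - apply: (is_derive_congr (is_derive_funD (is_derive_funD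
      (is_derive_funM (is_derive_const c s) (is_derive_funV _ (is_derive_funD
        (is_derive_const 1 s) (is_derive_funM (is_derive_const c s)
           (is_derive_var s)))))
      (is_derive_const (3 / (y - a) ^+ 2) s))
      (is_derive_const (3 / (b - y) ^+ 2) s))); [by rewrite gt_eqF ?cs0|by []|].
    by rewrite /vt/=; field; rewrite gt_eqF ?cs0.
  - apply: (is_derive_congr (is_derive_funD (is_derive_funD
      (is_derive_const (c / (1 + c * s)) y)
      (is_derive_funM (is_derive_const 3 y) (is_derive_funV _ (is_derive_funX 2
         (is_derive_funB (is_derive_var y) (is_derive_const a y))))))
      (is_derive_funM (is_derive_const 3 y) (is_derive_funV _ (is_derive_funX 2
         (is_derive_funB (is_derive_const b y) (is_derive_var y)))))));
      [by rewrite/= sqrf_eq0 subr_eq0 gt_eqF|by rewrite/= sqrf_eq0 subr_eq0 gt_eqF|by []|].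
    by rewrite /vx/=; field; rewrite !subr_eq0 !gt_eqF.
  - apply: (is_derive_congr (is_derive_funD
      (is_derive_funM (is_derive_const (- 6) y) (is_derive_funV _ (is_derive_funX 3
         (is_derive_funB (is_derive_var y) (is_derive_const a y)))))
      (is_derive_funM (is_derive_const 6 y) (is_derive_funV _ (is_derive_funX 3
         (is_derive_funB (is_derive_const b y) (is_derive_var y)))))));
      [by rewrite/= expf_eq0 subr_eq0 gt_eqF|by rewrite/= expf_eq0 subr_eq0 gt_eqF|by []|].
    by rewrite /vxx/=; field; rewrite !subr_eq0 !gt_eqF.
have le_v (s y : R) : 0 <= s -> a < y -> y < b -> y <= a + e \/ b - e <= y -> M <= v s y.
  move=> s0 ay yb ye; apply: (le_trans eM).
  have [h1 h2 h3] := vpos s y s0; rewrite /v.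
  have hle (z : R) : 0 < z -> z <= e -> 3 / e ^+ 2 <= 3 / z ^+ 2.
    move=> z0 ze; rewrite ler_pM2l// lef_pV2 ?posrE ?exprn_gt0//.
    by rewrite lerXn2r// nnegrE ltW.
  case: ye => ye.
    by have := hle (y - a); rewrite subr_gt0 => /(_ ay); lra.
  by have := hle (b - y); rewrite subr_gt0 => /(_ yb); lra.
apply: (@parabolic_comparison R u (dt u) (dx u) (dx (dx u)) v vt vx vxx
  0 t (a + e) (b - e)).
- exact: u_continuous_rect.
- apply: continuous_in_subspaceT => -[s y]; rewrite inE /= !in_itv/=.
  move=> [/andP[s0 _] /andP[ay yb]].
  have yI : a < y < b by apply/andP; split; lra.
  have [+ _ _] := dv _ _ s0 yI; have [_ + _] := dv _ _ (lexx 0) yI.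
  move=> /is_derive_continuous hy /is_derive_continuous hs.
  have [h1 h2] := @continuous_fst_snd R _ _ (s, y) hs hy.
  have -> : (fun z : R * R => v z.1 z.2) =
    (fun z : R * R => v z.1 y + v 0 z.2 - v 0 y).
    by apply/funext => z; rewrite /v; lra.
  exact: (cvgB (cvgD h1 h2) (cvg_cst _)).
- by move=> s y /andP[s0 _] _; exact: u_derive.
- move=> s y /andP[s0 _] /andP[ay yb]; apply: dv; first exact: ltW.
  by apply/andP; split; lra.
- move=> s y /andP[s0 _] /andP[ay yb]; have [h1 h2 h3] := vpos s y (ltW s0).
  split; first by rewrite /v; lra.
    by rewrite u_eq.
  (* With [B1] and [B2] the two stationary terms, [vxx / 2 = B1 ^ 2 + B2 ^ 2]; the cross terms of
     [v ^ 2] are nonnegative, which leaves [vxx / 2 - v ^ 2 <= vt]. *)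
  have -> : vxx s y = 2 * ((3 / (y - a) ^+ 2) ^+ 2 + (3 / (b - y) ^+ 2) ^+ 2).
    rewrite /vxx; field.
    by rewrite !subr_eq0 !gt_eqF//; lra.
  by rewrite /v /vt; nra.
- move=> y /andP[ay yb]; case: hu => _ -> _ _ _.
  have [_ h2 h3] := vpos 0 y (lexx 0).
  have : phi y <= c by apply: phic; apply/andP; split; lra.
  rewrite /v mulr0 addr0 divr1; lra.
- move=> s sI; have s0 : 0 <= s by case/andP: sI.
  split; (apply: (@le_trans _ _ M); first by apply: uM => //; apply/andP; split; lra).
    by apply: le_v => //; try lra; left.
  by apply: le_v => //; try lra; right.
- by rewrite lexx ltW.
- by apply/andP; split; lra.
Qed.

(** The barrier on [[x - L, x + L]] gives [c / (1 + c * t) + 6 / L ^ 2], whose first term is at most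
    [1 / t] for every [c]. Since [c] disappears, the bound is uniform over bounded initial values of
    any size. *)
Lemma positive_solution_le_inv (c t x : R) :
  0 <= c -> (forall y, phi y <= c) -> 0 < t -> u t x <= t^-1.
Proof.
move=> c0 phic t0; apply/ler_addgt0Pr => e e0.
pose L := (6 / e + 1).
have L1 : 1 < L by rewrite ltrDr divr_gt0.
have := @positive_solution_le_barrier c (x - L) (x + L) t x c0 (fun y _ => phic y) t0.
have xI : x - L < x < x + L by apply/andP; split; lra.
move=> /(_ xI); have -> : x - (x - L) = L by lra.
have -> : x + L - x = L by lra.
have ct : c / (1 + c * t) <= t^-1.
  have ct0 : 0 <= c * t by rewrite mulr_ge0// ltW.
  by rewrite ler_pdivrMr; first rewrite ler_pdivlMl //; lra.
have : 6 / L ^+ 2 <= e.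
  rewrite ler_pdivrMr; last by rewrite exprn_gt0//; lra.
  have : e * L = 6 + e by rewrite /L; field; rewrite gt_eqF.
  nra.
lra.
Qed.

(** From distance [rho] on the initial value is zero, so the barrier applies with [c = 0] on an
    interval with one end at [rho] or [- rho], by the sign of [x]. The other end is sent to
    infinity. *)
Lemma positive_solution_le_inv_sqr (rho t x : R) :
  (forall y, rho <= `|y| -> phi y = 0) -> 0 <= rho -> 0 < t -> rho < `|x| ->
  u t x <= 3 / (`|x| - rho) ^+ 2.
Proof.
move=> phi0 rho0 t0 rx; apply/ler_addgt0Pr => e e0.
pose L := (3 / e + 1).
have L1 : 1 < L by rewrite ltrDr divr_gt0.
have L2 : 3 / L ^+ 2 <= e.
  rewrite ler_pdivrMr; last by rewrite exprn_gt0//; lra.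
  have : e * L = 3 + e by rewrite /L; field; rewrite gt_eqF.
  nra.
have [x0|x0] := ler0P x; rewrite ?(ler0_norm x0) ?(gtr0_norm x0) in rx *.
- have := @positive_solution_le_barrier 0 (x - L) (- rho) t x (lexx _).
  rewrite mul0r add0r.
  have -> : x - (x - L) = L by lra.
  rewrite (_ : - rho - x = - x - rho); last by lra.
  move=> /(_ _ t0) H; have : u t x <= 3 / L ^+ 2 + 3 / (- x - rho) ^+ 2.
    apply: H; last by apply/andP; split; lra.
    by move=> y /andP[_ yr]; rewrite phi0// ler0_norm; lra.
  lra.
- have := @positive_solution_le_barrier 0 rho (x + L) t x (lexx _).
  rewrite mul0r add0r.
  have -> : x + L - x = L by lra.
  move=> /(_ _ t0) H; have : u t x <= 3 / (x - rho) ^+ 2 + 3 / L ^+ 2.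
    apply: H; last by apply/andP; split; lra.
    by move=> y /andP[yr _]; rewrite phi0// ger0_norm; lra.
  lra.
Qed.

(* [expR (- (2 * s / l ^ 2)) / (1 + s) * (1 - ((y - x) / l) ^ 2) ^ 2] is a
   subsolution vanishing at [y = x - l] and [y = x + l]. *)
Lemma positive_solution_ge (l t x : R) :
  0 < l -> (forall y, x - l <= y <= x + l -> 1 <= phi y) -> 0 < t ->
  expR (- (2 * t / l ^+ 2)) / (1 + t) <= u t x.
Proof.
move=> l0 phi1 t0.
pose a := 2 / l ^+ 2.
have a0 : 0 < a by rewrite divr_gt0// exprn_gt0.
pose h (s : R) : R := expR (- a * s) / (1 + s).
pose q (y : R) : R := (1 - ((y - x) / l) ^+ 2) ^+ 2.
pose v (s y : R) : R := h s * q y.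
pose vt (s y : R) : R := - (a * h s + expR (- a * s) / (1 + s) ^+ 2) * q y.
pose qx (y : R) : R := - 4 / l * ((y - x) / l) * (1 - ((y - x) / l) ^+ 2).
pose qxx (y : R) : R := 2 * a * (3 * ((y - x) / l) ^+ 2 - 1).
have dh (s : R) : 0 <= s ->
    is_derive s 1 h (- (a * h s + expR (- a * s) / (1 + s) ^+ 2)).
  move=> s0; have s1 : 1 + s != 0 by rewrite gt_eqF// ltr_wpDr.
  apply: (is_derive_congr (is_derive_funM
    (is_derive_fun_expR (is_derive_funM (is_derive_const (- a) s)
       (is_derive_var s)))
    (is_derive_funV _ (is_derive_funD (is_derive_const 1 s)
        (is_derive_var s))))); [by []|by []|].
  by rewrite /h/=; field.
have dy (y : R) := is_derive_funM (is_derive_funB (is_derive_var y)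
  (is_derive_const x y)) (is_derive_const l^-1 y).
have dq (y : R) : is_derive y 1 q (qx y).
  apply: (is_derive_congr (is_derive_funX 2
    (is_derive_funB (is_derive_const 1 y) (is_derive_funX 2 (dy y))))); first by [].
  by rewrite /qx/=; field; rewrite gt_eqF.
have dqx (y : R) : is_derive y 1 qx (qxx y).
  apply: (is_derive_congr (is_derive_funM
    (is_derive_funM (is_derive_const (- 4 / l) y) (dy y))
    (is_derive_funB (is_derive_const 1 y) (is_derive_funX 2 (dy y))))); first by [].
  by rewrite /qxx /a/=; field; rewrite gt_eqF.
(* The bump [q] equals 1 at its centre [x], so the claim is the comparison at that point. *)
have -> : expR (- (2 * t / l ^+ 2)) / (1 + t) = v t x.
  rewrite /v /h /q /a subrr mul0r expr0n subr0 expr1n mulr1.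
  by congr (expR _ / _); lra.
have qb (y : R) : x - l <= y <= x + l -> 0 <= q y <= 1.
  move=> /andP[y1 y2]; have z1 : ((y - x) / l) ^+ 2 <= 1.
    by rewrite expr_div_n ler_pdivrMr ?exprn_gt0// mul1r; nra.
  by rewrite sqr_ge0/= expr_le1 ?subr_ge0// gerBl sqr_ge0.
have eb (s : R) : 0 <= s -> 0 < expR (- a * s) <= 1.
  by move=> s0; rewrite expR_gt0/= -expR0 ler_expR; nra.
apply: (@parabolic_comparison R v vt (fun s y => h s * qx y)
  (fun s y => h s * qxx y) u (dt u) (dx u) (dx (dx u)) 0 t (x - l) (x + l)).
- apply: continuous_in_subspaceT => -[s y]; rewrite inE /= !in_itv/=.
  move=> [/andP[s0 _] _].
  have [h1 h2] := @continuous_fst_snd R h q (s, y)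
    (is_derive_continuous (dh _ s0)) (is_derive_continuous (dq y)).
  exact: (cvgM h1 h2).
- exact: u_continuous_rect.
- move=> s y /andP[s0 _] _; split.
  + apply: (is_derive_congr
      (is_derive_funM (dh s (ltW s0)) (is_derive_const (q y) s))); first by [].
    by rewrite mulr0 addr0.
  + apply: (is_derive_congr
      (is_derive_funM (is_derive_const (h s) y) (dq y))); first by [].
    by rewrite mul0r add0r.
  + apply: (is_derive_congr
      (is_derive_funM (is_derive_const (h s) y) (dqx y))); first by [].
    by rewrite mul0r add0r.
- by move=> s y /andP[s0 _] _; exact: u_derive.
- move=> s y /andP[s0 _] /andP[y1 y2]; split; [exact/u_ge0/ltW| |by rewrite u_eq].
  have := eb s (ltW s0); have := qb y; rewrite (ltW y1) (ltW y2) => /(_ isT).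
  rewrite /v /vt /h /qxx; set E := expR _; rewrite /q.
  set z := (y - x) / l => /andP[Q0 Q1] /andP[E0 E1].
  set Q := (1 - z ^+ 2) ^+ 2 in Q0 Q1 *.
  have s1 : 0 < 1 + s by rewrite ltr_wpDr// ltW.
  set w := (1 + s)^-1; have w0 : 0 < w by rewrite invr_gt0.
  rewrite -exprVn -/w -subr_ge0.
  (* The rate [a] turns [a * (3 * z ^ 2 - 1) + a * Q] into [a * (z ^ 2 + z ^ 4)], and the derivative
     of [1 / (1 + s)] pays for the square of the subsolution, as [E * Q <= 1]. Both resulting terms
     are nonnegative. *)
  have -> : 1 / 2 * (E * w * (2 * a * (3 * z ^+ 2 - 1))) - (E * w * Q) ^+ 2 -
      - (a * (E * w) + E * w ^+ 2) * Q =
    E * w * a * (z ^+ 2 + z ^+ 4) + E * w ^+ 2 * Q * (1 - E * Q).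
    by rewrite /Q; field.
  have EQ : E * Q <= 1 by rewrite mulr_ile1// ltW.
  have Ew0 : 0 <= E * w by rewrite mulr_ge0// ltW.
  apply: addr_ge0.
    by apply: mulr_ge0; [apply: mulr_ge0 => //; exact: ltW|nra].
  apply: mulr_ge0; last by rewrite subr_ge0.
  by apply: mulr_ge0 => //; rewrite expr2 mulrA mulr_ge0// ltW.
- move=> y yI; case: hu => _ -> _ _ _; apply: le_trans (phi1 y yI).
  rewrite /v /h mulr0 expR0 addr0 divr1 mul1r.
  by have /andP[] := qb _ yI.
- move=> s /andP[s0 _]; have hq (z : R) : z = l \/ z = - l -> (1 - (z / l) ^+ 2) ^+ 2 = 0.
    by move=> [] ->; field; rewrite gt_eqF.
  by rewrite /v /q !hq ?mulr0 ?u_ge0//; [left|right]; lra.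
- by rewrite lexx ltW.
- by apply/andP; split; lra.
Qed.

End positive_solution_bounds.

(** * Measurability on the state space *)

Section ereal_exp.
Context {R : realType}.

Lemma measurable_expeR : measurable_fun setT (@expeR R).
Proof.
have -> : @expeR R = fun x => if x == +oo%E then +oo%E else
    if x == -oo%E then 0%E else (expR (fine x))%:E.
  by apply/funext => -[].
apply: measurable_fun_ifT => //; first exact: measurable_fun_eqe.
apply: measurable_fun_ifT => //; first exact: measurable_fun_eqe.
by apply/measurable_EFinP; exact: measurableT_comp.
Qed.

End ereal_exp.

Section tent.
Context {R : realType}.
Implicit Types rho x : R.

Definition tent rho x : R := Num.max 0 (rho - `|x|).

Lemma tent_ge0 rho x : 0 <= tent rho x.
Proof. by rewrite le_max lexx. Qed.

Lemma tent_eq0 rho x : (tent rho x == 0) = (rho <= `|x|).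
Proof. by rewrite /tent eq_maxl subr_le0. Qed.

Lemma tent_ge rho x : rho - `|x| <= tent rho x.
Proof. by rewrite le_max lexx orbT. Qed.

Lemma tent_le rho x : 0 <= rho -> tent rho x <= rho.
Proof. by move=> rho0; rewrite ge_max rho0 gerBl normr_ge0. Qed.

Lemma continuous_maxr (f g : R -> R) : continuous f -> continuous g ->
  continuous (fun x => Num.max (f x) (g x)).
Proof.
move=> cf cg x; rewrite (_ : (fun x => _) =
  (fun x => (f x + g x + `|f x - g x|) / 2)); last first.
  by apply/funext => y; rewrite maxr_absE.
exact: (cvgM (cvgD (cvgD (cf x) (cg x)) (cvg_norm (cvgB (cf x) (cg x))))
             (cvg_cst _)).
Qed.

Lemma continuous_minr (f g : R -> R) : continuous f -> continuous g ->
  continuous (fun x => Num.min (f x) (g x)).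
Proof.
move=> cf cg x; rewrite (_ : (fun x => _) =
  (fun x => (f x + g x - `|f x - g x|) / 2)); last first.
  by apply/funext => y; rewrite minr_absE.
exact: (cvgM (cvgB (cvgD (cf x) (cg x)) (cvg_norm (cvgB (cf x) (cg x))))
             (cvg_cst _)).
Qed.

Lemma continuous_tent rho : continuous (tent rho).
Proof.
apply: continuous_maxr => x; first exact: cvg_cst.
exact: (cvgB (cvg_cst rho) (@norm_continuous _ R x)).
Qed.

Lemma Cc_of_eq0 (g : R -> R) rho : continuous g ->
  (forall x, rho <= `|x| -> g x = 0) -> Cc g.
Proof.
move=> cg g0; split => //.
apply: (subclosed_compact (@closed_closure _ _) (@segment_compact R (- rho) rho)).
have /closure_id -> : closed `[- rho, rho] by exact: interval_closed.
apply: closure_subset => x /= gx0; rewrite in_itv/= -ler_norml.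
by rewrite leNgt; apply: contra_neqN gx0 => /ltW /g0.
Qed.

End tent.

Section Mp_evaluation.
Context {R : realType} {p : R}.

(** Evaluation at a test function is continuous for the initial topology, hence Borel measurable,
    since open intervals generate the Borel sets of [R]. *)
Lemma measurable_Mp_eval (f : Mp_test p) :
  measurable_fun setT (fun mu : Mp p => Mp_eval mu f).
Proof.
have cf : continuous (fun mu : Mp p => Mp_eval mu f).
  move=> mu; apply: (@continuous_comp _ _ _ (@Mp_eval R p) (fun h => h f)).
    exact: initial_continuous.
  exact: proj_continuous.
apply: (measurability _ (RGenOpens.measurableE R)) => _ [_ [a [b ->] <-]].
rewrite setTI; apply: sub_sigma_algebra.
by apply: open_comp => //; exact: interval_open.
Qed.

Lemma Mp_integral_lty (mu : Mp p) (g : R -> R) (rho c : R) : continuous g ->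
  (forall x, 0 <= g x <= c) -> (forall x, rho <= `|x| -> g x = 0) ->
  (\int[mu]_x (g x)%:E < +oo)%E.
Proof.
move=> cg gc g0.
have c0 : 0 <= c by have /andP[] := gc 0; exact: le_trans.
apply: (@le_lt_trans _ _ (\int[mu]_x (c%:E * (\1_(`[- rho, rho]) x)%:E))%E).
  apply: ge0_le_integral => //.
  - by move=> x _; rewrite lee_fin; case/andP: (gc x).
  - apply/measurable_EFinP; exact: continuous_measurable_fun.
  - by apply: measurable_funeM; apply/measurable_EFinP; exact: measurable_indic.
  - move=> x _; rewrite -EFinM lee_fin indicE.
    have [xr|] := boolP (x \in _); first by rewrite mulr1; case/andP: (gc x).
    rewrite notin_setE/= in_itv/= -ler_norml => /negP; rewrite -ltNge => /ltW.
    by move=> /g0 ->; rewrite mulr0.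
rewrite ge0_integralZl//; last first.
  by apply/measurable_EFinP; exact: measurable_indic.
rewrite integral_indic// setIT lte_mul_pinfty//.
by apply: Mp_locally_finite; exact: segment_compact.
Qed.

(** [Mp_eval] uses the real-valued integral, which would turn [+oo] into 0; finiteness identifies it
    with the extended one. *)
Lemma measurable_Mp_integral (g : R -> R) (rho c : R) : continuous g ->
  (forall x, 0 <= g x <= c) -> (forall x, rho <= `|x| -> g x = 0) ->
  measurable_fun setT (fun mu : Mp p => (\int[mu]_x (g x)%:E)%E).
Proof.
move=> cg gc g0.
have tg : Mp_test p g.
  exists g; first exact: Cc_of_eq0 g0.
  by exists 0; apply/funext => x; rewrite mul0r addr0.
have -> : (fun mu : Mp p => (\int[mu]_x (g x)%:E)%E) =
    fun mu : Mp p => (Mp_eval mu (exist _ g (mem_set tg)))%:E.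
  apply/funext => mu; rewrite /Mp_eval/= /Rintegral fineK// ge0_fin_numE.
    exact: Mp_integral_lty g0.
  by apply: integral_ge0 => x _; rewrite lee_fin; case/andP: (gc x).
by apply/measurable_EFinP; exact: measurable_Mp_eval.
Qed.

Definition obal (rho : R) : set R := [set x | `|x| < rho].

Lemma measurable_obal rho : measurable (obal rho : set (measurableTypeR R)).
Proof.
have -> : obal rho = `]- rho, rho[%classic.
  by apply/seteqP; split => x; rewrite /obal/= in_itv/= ltr_norml.
exact: measurable_itv.
Qed.

(** The functions [g n] are continuous with compact support and increase to the indicator of the
    open ball, so monotone convergence exhibits the map as a pointwise limit of measurable maps. *)
Lemma measurable_Mp_obal rho : measurable_fun setT (fun mu : Mp p => mu (obal rho)).
Proof.
pose g n x : R := Num.min 1 (n%:R * tent rho x).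
have cg n : continuous (g n).
  apply: continuous_minr => x; first exact: cvg_cst.
  exact: (cvgM (cvg_cst _) (@continuous_tent _ rho x)).
have g01 n x : 0 <= g n x <= 1.
  by rewrite /g le_min ler01 ge_min lexx/= mulr_ge0// tent_ge0.
have g0 n x : rho <= `|x| -> g n x = 0.
  by rewrite -tent_eq0 => /eqP xr; rewrite /g xr mulr0 min_r.
apply: (@emeasurable_fun_cvg _ _ _ _
  (fun n (mu : Mp p) => (\int[mu]_x (g n x)%:E)%E)) => [n|mu _].
  exact: (measurable_Mp_integral (cg n) (g01 n) (g0 n)).
have -> : mu (obal rho) = (\int[mu]_x (\1_(obal rho) x)%:E)%E.
  by rewrite integral_indic ?setIT//; exact: measurable_obal.
have gcvg x : (g n x)%:E @[n --> \oo] --> (\1_(obal rho) x)%:E.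
  apply: cvg_near_cst; rewrite indicE /obal.
  have [xr|xr] := ltP `|x| rho; last first.
    apply: nearW => n; rewrite g0// memNset//=.
    by apply/negP; rewrite -leNgt.
  rewrite mem_set//=; near=> n; rewrite /g; congr EFin; apply: min_l.
  have t0 : 0 < tent rho x by rewrite lt_def tent_ge0 andbT tent_eq0 -ltNge.
  rewrite -ler_pdivrMr// mul1r; near: n; exact: nbhs_infty_ger.
have -> : (\int[mu]_x (\1_(obal rho) x)%:E)%E =
    (\int[mu]_x (limn (fun n => (g n x)%:E)))%E.
  by apply: eq_integral => x _; apply/esym/cvg_lim.
apply: cvg_monotone_convergence => //.
- by move=> n; apply/measurable_EFinP; exact: continuous_measurable_fun.
- by move=> n x _; rewrite lee_fin; case/andP: (g01 n x).
- move=> x _ m n mn; rewrite lee_fin /g le_min ge_min lexx/=.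
  by rewrite ge_min ler_wpM2r ?orbT ?tent_ge0// ler_nat.
Unshelve. all: by end_near. Qed.

End Mp_evaluation.

(** * Empty balls and Laplace transforms *)

Section empty_ball.
Context {R : realType} {p : R}.
Implicit Types (mu : Mp p) (rho : R).

Definition ball_empty rho : set (Mp p) := [set mu : Mp p | mu (obal rho) = 0%E].

Lemma measurable_ball_empty rho : measurable (ball_empty rho).
Proof.
rewrite (_ : ball_empty rho = (fun mu : Mp p => mu (obal rho)) @^-1` [set 0%E])//.
rewrite -[X in measurable X]setTI.
by apply: measurable_Mp_obal.
Qed.

Lemma integral_tent_eq0 mu rho :
  (\int[mu]_x (tent rho x)%:E)%E = 0%E <-> mu (obal rho) = 0%E.
Proof.
have mt : measurable_fun setT (fun x : measurableTypeR R => (tent rho x)%:E).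
  apply/measurable_EFinP; apply: continuous_measurable_fun.
  exact: continuous_tent.
have -> : (\int[mu]_x (tent rho x)%:E)%E = (\int[mu]_x `|(tent rho x)%:E|)%E.
  by apply: eq_integral => x _; rewrite gee0_abs// lee_fin tent_ge0.
have obalE : obal rho = [set x | tent rho x != 0].
  by apply/seteqP; split => x; rewrite /obal/= tent_eq0 ltNge.
split.
  move=> /(ae_eq_integral_abs mu measurableT mt) h.
  apply: measure_negligible; first exact: measurable_obal.
  apply: negligibleS h => x; rewrite obalE/= => /eqP tx.
  by move=> /(_ Logic.I) [].
move=> mu0; apply/(ae_eq_integral_abs mu measurableT mt).
exists (obal rho); split; [exact: measurable_obal|exact: mu0|].
move=> x /=; rewrite obalE/= => h; apply/eqP => tx; apply: h => _.
by rewrite tx.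
Qed.

Lemma measurable_Mp_tent (c : R) rho : 0 <= c -> 0 <= rho ->
  measurable_fun setT (fun mu : Mp p => (\int[mu]_x (c * tent rho x)%:E)%E).
Proof.
move=> c0 rho0; apply: (@measurable_Mp_integral _ _ _ rho (c * rho)).
- by move=> x; exact: (cvgM (cvg_cst _) (@continuous_tent _ rho x)).
- by move=> x; rewrite mulr_ge0 ?tent_ge0//= ler_wpM2l// tent_le.
- by move=> x; rewrite -tent_eq0 => /eqP ->; rewrite mulr0.
Qed.

Lemma integral_scaled_tent mu (c : R) rho : 0 <= c ->
  (\int[mu]_x (c * tent rho x)%:E = c%:E * \int[mu]_x (tent rho x)%:E)%E.
Proof.
move=> c0; under eq_integral do rewrite EFinM.
rewrite ge0_integralZl//.
- apply/measurable_EFinP; apply: continuous_measurable_fun.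
  exact: continuous_tent.
- by move=> x _; rewrite lee_fin tent_ge0.
Qed.

(** The integrand is [expR (- (n * I))] with [I] the finite integral of the tent: it tends to 1 if
    [I = 0], that is, on [ball_empty rho], and to 0 otherwise. The constant 1 dominates. *)
Lemma cvg_laplace_tent (Q : {measure set (Mp p) -> \bar R}) rho :
  Q setT = 1%E -> 0 <= rho ->
  (\int[Q]_nu expeR (- \int[nu]_x (n%:R * tent rho x)%:E))%E @[n --> \oo] -->
  Q (ball_empty rho).
Proof.
move=> Q1 rho0.
have mf n : measurable_fun setT (fun nu : Mp p =>
    expeR (- \int[nu]_x (n%:R * tent rho x)%:E)%E).
  apply: (measurableT_comp measurable_expeR).
  apply: (@measurableT_comp _ _ _ _ _ _ -%E) => //.
  exact: measurable_Mp_tent.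
have -> : Q (ball_empty rho) = (\int[Q]_nu (\1_(ball_empty rho) nu)%:E)%E.
  by rewrite integral_indic ?setIT//; exact: measurable_ball_empty.
have [|||||_ _ h] := @dominated_convergence _ _ _ Q setT measurableT
  (fun n nu => expeR (- \int[(nu : Mp p)]_x (n%:R * tent rho x)%:E)%E)
  (fun nu => (\1_(ball_empty rho) nu)%:E) (cst 1%E).
- exact: mf.
- by apply/measurable_EFinP; apply: measurable_indic; exact: measurable_ball_empty.
- apply: aeW => nu _ /=.
  under eq_fun do rewrite integral_scaled_tent//.
  have I0 : (0 <= \int[nu]_x (tent rho x)%:E)%E.
    by apply: integral_ge0 => x _; rewrite lee_fin tent_ge0.
  have Ioo : (\int[nu]_x (tent rho x)%:E < +oo)%E.
    apply: (@Mp_integral_lty _ _ nu _ rho rho); first exact: continuous_tent.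
      by move=> x; rewrite tent_ge0 tent_le.
    by move=> x; rewrite -tent_eq0 => /eqP.
  rewrite indicE.
  have [/set_mem nu0|nu0] := boolP (nu \in ball_empty rho).
    rewrite (integral_tent_eq0 _ _).2//.
    by under eq_fun do rewrite mule0 oppe0 expeR0; exact: cvg_cst.
  have : (\int[nu]_x (tent rho x)%:E)%E != 0%E.
    apply/eqP => /integral_tent_eq0 nu0'.
    by move: nu0; rewrite notin_setE; apply.
  move: I0 Ioo; case: (\int[nu]_x (tent rho x)%:E)%E => // a.
  rewrite lee_fin eqe => a0 _ an0.
  have {an0}a0 : 0 < a by rewrite lt_def an0.
  under eq_fun do rewrite -EFinM -EFinN /=.
  apply: cvg_EFin; first exact: nearW.
  under eq_fun do rewrite -mulrN expRM_natl.
  by apply: cvg_expr; rewrite ger0_norm ?expR_ge0// expR_lt1 oppr_lt0.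
- apply/integrableP; split => //; under eq_integral do rewrite /= normr1.
  by rewrite integral_cst// mul1e Q1 ltry.
- apply: aeW => nu n _; rewrite gee0_abs ?expeR_ge0// -expeR0 lee_expeR.
  rewrite leeNl oppe0; apply: integral_ge0 => x _.
  by rewrite lee_fin mulr_ge0// tent_ge0.
- exact: h.
Qed.

Lemma phi_gt0 (q x : R) : 0 < phi_ q x.
Proof. by rewrite powR_gt0// ltr_pwDl// sqr_ge0. Qed.

(** Off the ball the ratio to [phi_ p] is zero; inside, [phi_ p x] is at least [phi_ p rho] because
    it decreases with [|x|]. *)
Lemma laplace_test_tent (c : R) rho : 0 <= c -> 0 <= rho -> 0 < p ->
  laplace_test p (fun x => c * tent rho x).
Proof.
move=> c0 rho0 p0; split.
- by move=> x; rewrite mulr_ge0// tent_ge0.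
- by move=> x; exact: (cvgM (cvg_cst _) (@continuous_tent _ rho x)).
- exists (c * rho / phi_ p rho) => _ [x _ <-].
  have [xr|xr] := leP rho `|x|.
    move: xr; rewrite -tent_eq0 => /eqP ->; rewrite mulr0 mul0r.
    by rewrite !mulr_ge0// invr_ge0 ltW// phi_gt0.
  apply: ler_pM; rewrite ?mulr_ge0 ?tent_ge0 ?invr_ge0 ?(ltW (phi_gt0 _ _))//.
    by rewrite ler_wpM2l// tent_le.
  rewrite lef_pV2 ?posrE ?phi_gt0// /phi_.
  rewrite mulNr !powRN lef_pV2 ?posrE ?powR_gt0 ?ltr_pwDl ?sqr_ge0//.
  rewrite ge0_ler_powR ?nnegrE ?addr_ge0 ?sqr_ge0 ?divr_ge0 ?ltW//.
  by rewrite ltrD2l -(real_normK (num_real x)) ltrXn2r.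
Qed.

End empty_ball.

(** * Bounds on the transition probabilities *)

Section layers.
Context {R : realType}.
Implicit Types rho t K x : R.

Definition layer_weight t (j : nat) : R := 3 / (t * 4 ^+ j.+1).
(** The distances to the ball of radius [rho] double while the weights are divided by 4, which
    matches the decay of [3 / (|x| - rho) ^ 2]. *)
Definition layer_radius rho K (j : nat) : R := rho + K * 2 ^+ j.+1.

Lemma layer_weight_ge0 t j : 0 < t -> 0 <= layer_weight t j.
Proof. by move=> t0; rewrite divr_ge0// mulr_ge0// ltW. Qed.

Lemma layer_radius_ge0 rho K j : 0 <= rho -> 0 <= K -> 0 <= layer_radius rho K j.
Proof. by move=> rho0 K0; rewrite addr_ge0// mulr_ge0. Qed.

Let tail t j : R := t^-1 * 4^-1 ^+ j.

Let layer_weightE t j : 0 < t -> layer_weight t j = tail t j - tail t j.+1.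
Proof.
move=> t0; rewrite /layer_weight /tail !exprVn exprS.
by field; rewrite expf_neq0// gt_eqF.
Qed.

(* The sum is a layer-cake upper bound of [min (1 / t) (3 / (|x| - rho) ^ 2)]:
   the weights from [j] on add up to [1 / (t * 4 ^ j)]. *)
Lemma le_layers rho t K x (v : R) : 0 <= rho -> 0 < t -> 0 < K -> 3 * t <= K ^+ 2 ->
  v <= t^-1 -> (rho < `|x| -> v <= 3 / (`|x| - rho) ^+ 2) ->
  (v%:E <= \sum_(j <oo)
     ((layer_weight t j)%:E * (\1_(obal (layer_radius rho K j)) x)%:E))%E.
Proof.
move=> rho0 t0 K0 tK vt vx.
(* [k] is the first layer containing [x]. For [k = 0] the bound [1 / t] suffices; otherwise
   minimality gives [|x| - rho >= K * 2 ^ k], and [3 * t <= K ^ 2] bounds the inverse square by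
   [1 / (t * 4 ^ k)]. *)
have [k kx vk] : exists2 k, `|x| < layer_radius rho K k & v <= tail t k.
  have exk : exists k, `|x| < layer_radius rho K k.
    exists (Num.bound (`|x| / K)).
    have := archi_boundP (divr_ge0 (normr_ge0 x) (ltW K0)).
    rewrite ltr_pdivrMr// => /lt_le_trans; apply; rewrite /layer_radius mulrC.
    rewrite -[X in X <= _]add0r lerD// ler_wpM2l// ?ltW//.
    by rewrite -natrX ltr_nat (leq_trans (ltn_expl _ (ltnSn 1)))// leq_exp2l.
  case: (ex_minnP exk) => k kx kmin; exists k => //.
  case: k kx kmin => [|k] kx kmin; first by rewrite /tail expr0 mulr1.
  have : layer_radius rho K k <= `|x|.
    by rewrite leNgt; apply/negP => /kmin; rewrite ltnn.
  rewrite /layer_radius => xk.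
  have Kk : 0 < K * 2 ^+ k.+1 by rewrite mulr_gt0// exprn_gt0.
  apply: le_trans (vx _) _; first by apply: lt_le_trans xk; rewrite ltrDl.
  rewrite /tail exprVn -invfM -[X in _ <= X]div1r.
  rewrite ler_pdivrMr ?exprn_gt0 ?subr_gt0//; last first.
    by apply: lt_le_trans xk; rewrite ltrDl.
  rewrite mulrAC mul1r ler_pdivlMr; last by rewrite mulr_gt0// exprn_gt0.
  have : (K * 2 ^+ k.+1) ^+ 2 <= (`|x| - rho) ^+ 2.
    by apply: lerXn2r; rewrite ?nnegrE; lra.
  apply: le_trans; rewrite exprMn -exprM mulnC exprM.
  rewrite (_ : 2 ^+ 2 = 4); last by rewrite -natrX.
  by rewrite mulrA ler_wpM2r ?exprn_ge0.
apply: (@le_trans _ _ (tail t k)%:E); first by rewrite lee_fin.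
have cv : (tail t k - tail t (k + m)%N)%:E @[m --> \oo] --> (tail t k)%:E.
  apply: cvg_EFin; first exact: nearW.
  rewrite -[X in _ --> X]subr0; apply: cvgB; first exact: cvg_cst.
  rewrite (_ : (fun m => tail t (k + m)) = (fun m => tail t k * 4^-1 ^+ m)).
    rewrite -[X in _ --> X](mulr0 (tail t k)); apply: cvgM; first exact: cvg_cst.
    by apply: cvg_expr; rewrite ger0_norm// invf_lt1// ltr1n.
  by apply/funext => m; rewrite /tail exprD mulrA.
rewrite -(cvg_lim _ cv)//; apply: lime_le; first by apply/cvg_ex; eexists; exact: cv.
(* All layers from [k] on contain [x], so their weights alone contribute the telescoping sum
   [tail t k - tail t (k + m)]. *)
apply: nearW => m; apply: le_trans (nneseries_lim_ge (k + m) _); last first.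
  by move=> j _; rewrite mule_ge0// lee_fin// layer_weight_ge0.
rewrite (big_cat_nat (n := k))//= ?leq_addr//.
rewrite -[X in (X <= _)%E]add0e leeD//.
  by apply: sume_ge0 => j _; rewrite mule_ge0// lee_fin// layer_weight_ge0.
have -> : (tail t k - tail t (k + m))%:E =
    (\sum_(k <= j < k + m) (layer_weight t j)%:E)%E.
  rewrite sumEFin (@telescope_sumr_eq _ _ _ (fun j => - tail t j)) ?leq_addr//.
    by rewrite opprK addrC.
  by move=> j _; rewrite layer_weightE// opprK addrC.
rewrite !big_nat; apply: lee_sum => j /andP[kj _].
rewrite indicE mem_set ?mule1// /obal/=; apply: (lt_le_trans kx).
by rewrite lerD2l ler_wpM2l ?(ltW K0)// ler_weXn2l// ler1n.
Qed.

(** [2 * layer_radius rho K j] is the mean number of Poisson points in the ball of layer [j]. The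
    weights add up to [1 / t], and the distances contribute [6 * K / t] times a geometric series of
    ratio 1/2 and sum 1. *)
Lemma layers_mean_le rho t K : 0 <= rho -> 0 < t -> 0 <= K ->
  (\sum_(j <oo) ((layer_weight t j)%:E * (2 * layer_radius rho K j)%:E) <=
   (2 * rho / t + 6 * K / t)%:E)%E.
Proof.
move=> rho0 t0 K0.
have w0 j : (0 <= (layer_weight t j)%:E * (2 * layer_radius rho K j)%:E)%E.
  by rewrite mule_ge0// lee_fin ?layer_weight_ge0// mulr_ge0// layer_radius_ge0.
apply: lime_le; first by apply: is_cvg_nneseries => j _ _.
apply: nearW => n.
pose c j : R := 2 * rho * tail t j + 6 * K / t * 2^-1 ^+ j.
rewrite (eq_bigr (fun j => (c j - c j.+1)%:E)); last first.
  move=> j _; rewrite -EFinM; congr EFin; rewrite layer_weightE//.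
  rewrite /c /tail /layer_radius !exprVn !exprS.
  rewrite (_ : 4 = 2 * 2); last by rewrite -natrM.
  rewrite exprMn; field.
  by rewrite expf_neq0// gt_eqF.
rewrite sumEFin lee_fin (@telescope_sumr_eq _ _ _ (fun j => - c j))//; last first.
  by move=> j _; rewrite opprK addrC.
rewrite opprK addrC; apply: (@le_trans _ _ (c 0)).
  rewrite gerBl /c /tail addr_ge0// !mulr_ge0// ?exprn_ge0// ?invr_ge0// ltW//.
by rewrite /c /tail !expr0 !mulr1.
Qed.

End layers.

Section transition_bounds.
Context {R : realType} {p : R} (Q : R -> R.-pker Mp p ~> Mp p).
Hypotheses (p0 : 0 < p) (hQ : super_brownian_transition Q).
Implicit Types (rho t K l : R) (mu : Mp p).

(** The limit of the Laplace functionals at [n * tent rho], with solutions [u n] chosen once for all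
    [t] and [mu]. *)
Lemma transition_ball_empty_cvg rho : 0 <= rho ->
  exists2 u : nat -> R -> R -> R,
    forall n, positive_solution (fun x => n%:R * tent rho x) (u n) &
    forall t mu, 0 <= t ->
      expeR (- \int[mu]_x (u n t x)%:E)%E @[n --> \oo] --> Q t mu (ball_empty rho).
Proof.
move=> rho0.
have ex n : exists u : R -> R -> R,
    positive_solution (fun x => n%:R * tent rho x) u /\
    forall t mu, 0 <= t ->
      (\int[Q t mu]_nu expeR (- \int[nu]_x (n%:R * tent rho x)%:E) =
       expeR (- \int[mu]_x (u t x)%:E))%E.
  by have [u [hu _] hQu] := hQ (@laplace_test_tent R p n%:R rho (ler0n _ n) rho0 p0);
    exists u.
have [u hu] := choice ex.
exists u => [n|t mu t0]; first by have [] := hu n.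
have h := @cvg_laplace_tent R p (Q t mu) rho (prob_kernel _) rho0.
apply: cvg_trans h; apply: near_eq_cvg; apply: nearW => n.
by have [_ /(_ t mu t0) <-] := hu n.
Qed.

(** If [|x| < rho - 2 * l], every [y] within [l] of [x] has [tent rho y >= l], so the initial value
    is at least 1 there once [n * l >= 1], and [positive_solution_ge] applies. *)
Lemma transition_ball_empty_le rho l t mu : 0 <= rho -> 0 < l -> 0 < t ->
  (Q t mu (ball_empty rho) <=
   expeR (- ((expR (- (2 * t / l ^+ 2)) / (1 + t))%:E * mu (obal (rho - 2 * l)))))%E.
Proof.
move=> rho0 l0 t0; have [u hu] := transition_ball_empty_cvg rho0.
move=> /(_ t mu (ltW t0)) cv; rewrite -(cvg_lim _ cv)//.
apply: lime_le; first by apply/cvg_ex; eexists; exact: cv.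
near=> n; rewrite lee_expeR leeN2 -[obal _]setIT.
set c := _ / (1 + t).
have c0 : 0 <= c by rewrite divr_ge0 ?expR_ge0// addr_ge0// ltW.
rewrite -integral_indic//; last exact: measurable_obal.
rewrite -ge0_integralZl//; last first.
  by apply/measurable_EFinP; apply: measurable_indic; exact: measurable_obal.
have un0 x : 0 <= u n t x by have [+ _ _ _ _] := hu n; apply; exact: ltW.
apply: ge0_le_integral => //.
- by move=> x _; rewrite mule_ge0// lee_fin.
- apply: measurable_funeM.
  by apply/measurable_EFinP; apply: measurable_indic; exact: measurable_obal.
- apply/measurable_EFinP; apply: continuous_measurable_fun.
  exact: (positive_solution_continuous (hu n)).
- move=> x _; rewrite -EFinM lee_fin indicE.
  have [/set_mem|_] := boolP (x \in _); last by rewrite mulr0.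
  rewrite /obal/= mulr1 => xr.
  apply: (positive_solution_ge (hu n)) => // y /andP[y1 y2].
  have nl : 1 <= n%:R * l.
    by rewrite -ler_pdivrMr// div1r; near: n; exact: nbhs_infty_ger.
  have : `|y| <= `|x| + l.
    have -> : y = x + (y - x) by lra.
    rewrite (le_trans (ler_normD _ _))// lerD2l ler_norml.
    by apply/andP; split; lra.
  have := tent_ge rho y; move=> h1 h2.
  apply: (le_trans nl); rewrite ler_wpM2l//; lra.
Unshelve. all: by end_near. Qed.

(** Both upper bounds on [u n] are uniform in [n], so [le_layers] bounds [u n t] by one fixed sum of
    weighted indicators, which is integrated term by term. *)
Lemma transition_ball_empty_ge rho t K mu : 0 <= rho -> 0 < t -> 0 < K ->
  3 * t <= K ^+ 2 ->
  (expeR (- \sum_(j <oo)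
     ((layer_weight t j)%:E * mu (obal (layer_radius rho K j)))) <=
   Q t mu (ball_empty rho))%E.
Proof.
move=> rho0 t0 K0 tK; have [u hu] := transition_ball_empty_cvg rho0.
move=> /(_ t mu (ltW t0)) cv; rewrite -(cvg_lim _ cv)//.
apply: lime_ge; first by apply/cvg_ex; eexists; exact: cv.
apply: nearW => n; rewrite lee_expeR leeN2.
have un0 x : 0 <= u n t x by have [+ _ _ _ _] := hu n; apply; exact: ltW.
have mI r : measurable_fun setT
    (fun x : measurableTypeR R => (\1_(obal r) x)%:E : \bar R).
  by apply/measurable_EFinP; apply: measurable_indic; exact: measurable_obal.
have w0 j x : (0 <= (layer_weight t j)%:E *
    (\1_(obal (layer_radius rho K j)) x)%:E)%E.
  by rewrite mule_ge0// lee_fin// layer_weight_ge0.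
apply: (@le_trans _ _ (\int[mu]_x (\sum_(j <oo) ((layer_weight t j)%:E *
    (\1_(obal (layer_radius rho K j)) x)%:E)))%E).
  apply: ge0_le_integral => //.
  - by move=> x _; rewrite lee_fin.
  - apply/measurable_EFinP; apply: continuous_measurable_fun.
    exact: (positive_solution_continuous (hu n)).
  - apply: ge0_emeasurable_sum => [j x _ _|j _]; first exact: w0.
    exact: measurable_funeM.
  - move=> x _; apply: le_layers => //.
      apply: (@positive_solution_le_inv _ _ _ (hu n) (n%:R * rho)) => //.
        by rewrite mulr_ge0.
      by move=> y; rewrite ler_wpM2l// tent_le.
    move=> xr; apply: (positive_solution_le_inv_sqr (hu n)) => // y.
    by rewrite -tent_eq0 => /eqP ->; rewrite mulr0.
rewrite integral_nneseries//; last by move=> j; exact: measurable_funeM.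
apply: lee_nneseries => [j _ _|j _]; first by apply: integral_ge0 => x _; exact: w0.
rewrite ge0_integralZl//; last by rewrite lee_fin layer_weight_ge0.
by rewrite integral_indic ?setIT//; exact: measurable_obal.
Qed.

End transition_bounds.

(** * Averaging over the Poisson initial value *)

Section poisson.
Context {R : realType}.

Lemma nneseries_exp (x : R) : (\sum_(k <oo) (x ^+ k / k`!%:R)%:E = (expR x)%:E)%E.
Proof.
apply/cvg_lim => //; apply: (@cvg_trans _ (EFin \o series (exp_coeff x) @ \oo)).
  apply: near_eq_cvg; apply: nearW => n /=.
  by rewrite /series/= -sumEFin.
by apply: cvg_EFin; [exact: nearW|exact: is_cvg_series_exp_coeff].
Qed.

Context {d : measure_display} {T : measurableType d} (P : probability T R).
Variables (N : T -> \bar R) (m : R).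
Hypotheses (mN : measurable_fun setT N) (m0 : 0 <= m).
Hypothesis PN : forall k : nat,
  P [set w | N w = k%:R%:E] = (expR (- m) * m ^+ k / k`!%:R)%:E.

Lemma poisson_expectation (h : \bar R -> \bar R) :
  measurable_fun setT h -> (forall y, 0 <= h y)%E ->
  (\int[P]_w h (N w) =
   \sum_(k <oo) ((expR (- m))%:E * (h k%:R%:E * (m ^+ k / k`!%:R)%:E)))%E.
Proof.
move=> mh h0.
pose E k := [set w | N w = k%:R%:E].
have mE k : measurable (E k).
  rewrite (_ : E k = N @^-1` [set k%:R%:E])// -[X in measurable X]setTI.
  by apply: mN.
have tE : trivIset setT E.
  move=> i j _ _ [w [/= Ni]]; rewrite /E/= Ni => -[] /eqP.
  by rewrite eqr_nat => /eqP.
have mhN D : measurable_fun D (h \o N).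
  by apply: measurable_funTS; exact: measurableT_comp.
have mU : measurable (\bigcup_k E k) by exact: bigcupT_measurable.
(* The Poisson weights sum to 1, so the values of [N] other than natural numbers, [+oo] included,
   have probability 0. *)
have PU : P (~` \bigcup_k E k) = 0%E.
  rewrite probability_setC// measure_semi_bigcup//.
  rewrite (eq_eseriesr (g := fun k =>
    ((expR (- m))%:E * (m ^+ k / k`!%:R)%:E)%E)); last first.
    by move=> k _; rewrite [LHS]PN -mulrA EFinM.
  rewrite nneseriesZl; last first.
    by move=> k _; rewrite lee_fin divr_ge0// exprn_ge0.
  rewrite nneseries_exp -EFinM -expRD addNr expR0 subee//.
rewrite (ge0_negligible_integral (N := ~` \bigcup_k E k))//; last exact: measurableC.
rewrite setTD setCK ge0_integral_bigcup//.
apply: eq_eseriesr => k _.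
rewrite (eq_integral (cst (h k%:R%:E))); last first.
  by move=> w /set_mem ->.
by rewrite integral_cst// [X in (_ * X)%E]PN -mulrA EFinM muleCA.
Qed.

Lemma poisson_mean : (forall w, 0 <= N w)%E -> (\int[P]_w N w = m%:E)%E.
Proof.
move=> N0; under eq_integral do rewrite -(gee0_abs (N0 _)).
rewrite (poisson_expectation (h := abse))//.
rewrite nneseriesZl; last first.
  by move=> k _; rewrite mule_ge0// lee_fin divr_ge0// exprn_ge0.
have k0 k : (0 <= `|k%:R%:E| * (m ^+ k / k`!%:R)%:E)%E.
  by rewrite mule_ge0// lee_fin divr_ge0// exprn_ge0.
(* The term [k = 0] vanishes, and shifting the index turns [k * m ^ k / k!] into [m] times the
   exponential series. *)
rewrite nneseries_recl// abse0 mul0e add0e -nneseries_addn//.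
rewrite (eq_eseriesr (g := fun k => (m%:E * (m ^+ k / k`!%:R)%:E)%E)); last first.
  move=> k _; rewrite addn1 gee0_abs ?lee_fin// -!EFinM factS natrM exprS.
  congr EFin; field; rewrite pnatr_eq0 -lt0n fact_gt0/=.
  by rewrite gt_eqF// ltr_pwDl.
rewrite nneseriesZl; last first.
  by move=> k _; rewrite lee_fin divr_ge0// exprn_ge0.
by rewrite nneseries_exp -!EFinM mulrCA -expRD addNr expR0 mulr1.
Qed.

(** The factor [expR (- (c * k))] turns the exponential series at [m] into the one at
    [m * expR (- c)]. *)
Lemma poisson_laplace (c : R) :
  (\int[P]_w expeR (- (c%:E * N w)) = (expR (- (m * (1 - expR (- c)))))%:E)%E.
Proof.
rewrite (poisson_expectation (h := fun y => expeR (- (c%:E * y))%E)); last 2 first.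
- apply: (measurableT_comp measurable_expeR).
  apply: (@measurableT_comp _ _ _ _ _ _ -%E) => //.
  by apply: measurable_funeM; exact: measurable_id.
- by move=> y; exact: expeR_ge0.
under eq_eseriesr => k _.
  have -> : (expeR (- (c%:E * k%:R%:E)) * (m ^+ k / k`!%:R)%:E =
             ((m * expR (- c)) ^+ k / k`!%:R)%:E)%E.
    rewrite /= -EFinM mulrA; congr (_ / _)%:E.
    by rewrite exprMn -expRM_natr mulNr mulrC.
  over.
rewrite nneseriesZl; last first.
  by move=> k _; rewrite lee_fin divr_ge0// exprn_ge0// mulr_ge0// expR_ge0.
rewrite nneseries_exp -EFinM -expRD; congr (expR _)%:E; lra.
Qed.

End poisson.

Section final_estimates.
Context {R : realType} {p : R}.

(** The supremum need not be attained a priori, but the open ball is the countable union of the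
    balls of radius [r * t - 1 / (n + 1)], each of measure zero. *)
Lemma le_empty_radiusE (mu : Mp p) (r t : R) : 0 < r -> 0 < t ->
  (r%:E <= empty_radius mu / t%:E)%E <-> ball_empty (r * t) mu.
Proof.
move=> r0 t0; rewrite inver gt_eqF// lee_pdivlMr// -EFinM.
have rt0 : 0 < r * t by rewrite mulr_gt0.
split; last first.
  by move=> h; apply: ereal_sup_ubound; right; exists (r * t).
move=> h.
have obal_null n : mu.-negligible (obal (r * t - n.+1%:R^-1)).
  have : ((r * t - n.+1%:R^-1)%:E < empty_radius mu)%E.
    by apply: lt_le_trans h; rewrite lte_fin gtrBl invr_gt0.
  (* The witness may be the 0 added by the convention on the empty set; then
     [r * t - 1 / (n + 1) < 0] and the ball has no point. *)
  move=> /ereal_sup_gt[_ [->|[u [u0 muu] <-]]]; rewrite lte_fin => ru.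
    exists set0; split => //.
    move=> x; rewrite /obal/= => xr.
    by have := le_lt_trans (normr_ge0 x) (lt_trans xr ru); rewrite ltxx.
  exists (obal u); split => //; first exact: measurable_obal.
  by move=> x; rewrite /obal/= => /lt_trans; apply.
apply: measure_negligible; first exact: measurable_obal.
apply: negligibleS (negligible_bigcup obal_null) => x; rewrite /obal/= => xr.
have [n hn] : exists n : nat, n.+1%:R^-1 < r * t - `|x|.
  have d0 : 0 < r * t - `|x| by rewrite subr_gt0.
  exists (Num.bound (r * t - `|x|)^-1).
  rewrite invf_plt ?posrE//; apply: lt_trans (archi_boundP _) _.
    by rewrite invr_ge0 ltW.
  by rewrite ltr_nat.
by exists n => //; rewrite /obal/= ltrBrDr addrC -ltrBrDr.
Qed.

Lemma lebesgue_measure_obal (s : R) : 0 <= s ->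
  lebesgue_measure (obal s : set R) = (2 * s)%:E.
Proof.
move=> s0; have -> : obal s = `]- s, s[%classic.
  by apply/seteqP; split => x; rewrite /obal/= in_itv/= ltr_norml.
rewrite lebesgue_measure_itv/= lte_fin.
case: ifPn => [_|]; first by rewrite -EFinD; congr EFin; lra.
by rewrite -leNgt => h; congr EFin; lra.
Qed.

Context {d : measure_display} {Omega : measurableType d}
  (P : probability Omega R).

(* Jensen's inequality by the tangent line of [y |-> exp (- y)] at [M]. *)
Lemma expR_mean_le (Y : Omega -> \bar R) (M : R) : measurable_fun setT Y ->
  (forall w, 0 <= Y w)%E -> (\int[P]_w Y w <= M%:E)%E ->
  ((expR (- M))%:E <= \int[P]_w expeR (- Y w))%E.
Proof.
move=> mY Y0 YM.
have M0 : 0 <= M.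
  by rewrite -lee_fin (le_trans _ YM)//; apply: integral_ge0.
have mE : measurable_fun setT (fun w => expeR (- Y w)).
  apply: (measurableT_comp measurable_expeR).
  exact: (@measurableT_comp _ _ _ _ _ _ -%E).
(* The tangent inequality with its negative term moved to the right, so that both integrands are
   nonnegative and the value [+oo] of [Y] is allowed. *)
have : (\int[P]_w (expR (- M) * (1 + M))%:E <=
    \int[P]_w (expeR (- Y w) + (expR (- M))%:E * Y w))%E.
  apply: ge0_le_integral => //.
  - by move=> w _; rewrite lee_fin mulr_ge0 ?expR_ge0// addr_ge0.
  - by apply: emeasurable_funD => //; exact: measurable_funeM.
  - move=> w _; have := Y0 w; case: (Y w) => [y|_|//].
      rewrite lee_fin => y0 /=; rewrite -EFinM -EFinD lee_fin.
      have -> : expR (- y) = expR (- M) * expR (M - y).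
        by rewrite -expRD; congr expR; lra.
      have := expR_ge1Dx (M - y); have := expR_gt0 (- M); nra.
    by rewrite /= gt0_muley ?lte_fin ?expR_gt0// add0e leey.
rewrite integral_cst// [X in (_ * X)%E](@probability_setT _ _ _ P) mule1.
rewrite ge0_integralD//; last 3 first.
- by move=> w _; exact: expeR_ge0.
- by move=> w _; rewrite mule_ge0// lee_fin expR_ge0.
- exact: measurable_funeM.
rewrite ge0_integralZl//.
have eM0 : (0 <= (expR (- M))%:E)%E by rewrite lee_fin expR_ge0.
move=> h; have := le_trans h (leeD2l _ (lee_wpmul2l eM0 YM)).
rewrite -EFinM -leeBlDr//.
by rewrite -EFinB mulrDr mulr1 addrK.
Qed.

Context (X : R -> Omega -> Mp p) (Q : R -> R.-pker Mp p ~> Mp p).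
Hypotheses (p0 : 0 < p) (hQ : super_brownian_transition Q).
Hypotheses (hX : markov_process P Q X)
  (hX0 : poisson_random_measure P lebesgue_measure (X 0)).

Let mX0 : measurable_fun setT (X 0). Proof. by case: hX0. Qed.

(** This is the Markov property at time 0 on the sure event. *)
Lemma prob_empty_radius (r t : R) : 0 < r -> 0 < t ->
  (P [set w | (r%:E <= empty_radius (X t w) / t%:E)%E] =
   \int[P]_w Q t (X 0 w) (ball_empty (r * t)))%E.
Proof.
move=> r0 t0; case: hX => _ /(_ 0 t setT (ball_empty (r * t)) (lexx 0) (ltW t0)).
have pT : past X 0 setT.
  by move=> S [[S0 SC _] _]; rewrite -(setD0 setT); exact: SC.
move=> /(_ pT) <-; last exact: measurable_ball_empty.
rewrite setTI add0r; congr (P _); apply/seteqP; split => w /=.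
  by move=> /le_empty_radiusE; apply.
by move=> h; apply/le_empty_radiusE.
Qed.

Let measurable_Q t s : measurable_fun setT (fun w => Q t (X 0 w) (ball_empty s)).
Proof.
apply: (@measurableT_comp _ _ _ _ _ _ (fun mu => Q t mu (ball_empty s))) => //.
by apply: measurable_kernel; exact: measurable_ball_empty.
Qed.

Let measurable_X0_obal s : measurable_fun setT (fun w => X 0 w (obal s)).
Proof.
exact: (measurableT_comp (@measurable_Mp_obal R p s) mX0).
Qed.

Let X0_obal s k : 0 <= s ->
  P [set w | X 0 w (obal s) = k%:R%:E] =
  (expR (- (2 * s)) * (2 * s) ^+ k / k`!%:R)%:E.
Proof.
move=> s0; case: hX0 => _ /(_ (obal s) (measurable_obal _)) + _.
rewrite [X in (X < _)%E](lebesgue_measure_obal s0) => /(_ (ltry _) k) ->.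
by rewrite ![X in fine X](lebesgue_measure_obal s0).
Qed.

(** The number of initial points in [obal (s - 2 * l)] is Poisson, and its Laplace transform at [c]
    is explicit. The rational form comes from [1 - expR (- c) >= c / (1 + c)], where
    [1 / c = (1 + t) * expR (2 * t / l ^ 2)]. *)
Lemma prob_ball_empty_le (s l t : R) : 0 < l -> 2 * l <= s -> 0 < t ->
  (\int[P]_w Q t (X 0 w) (ball_empty s) <=
   (expR (- (2 * (s - 2 * l) /
      (1 + (1 + t) * expR (2 * t / l ^+ 2)))))%:E)%E.
Proof.
move=> l0 ls t0; set c := expR (- (2 * t / l ^+ 2)) / (1 + t).
have s0 : 0 <= s by lra.
have c0 : 0 < c by rewrite divr_gt0 ?expR_gt0// addr_gt0.
have sl : 0 <= 2 * (s - 2 * l) by lra.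
apply: (@le_trans _ _ (\int[P]_w expeR (- (c%:E * X 0 w (obal (s - 2 * l)))))%E).
  apply: ge0_le_integral => //.
    apply: (measurableT_comp measurable_expeR).
    apply: (@measurableT_comp _ _ _ _ _ _ -%E) => //.
    exact: measurable_funeM.
  by move=> w _; exact: transition_ball_empty_le.
rewrite (poisson_laplace (m := 2 * (s - 2 * l)))//; last first.
  by move=> k; apply: X0_obal; lra.
rewrite lee_fin ler_expR lerN2 ler_wpM2l//.
have cV : c^-1 = (1 + t) * expR (2 * t / l ^+ 2).
  by rewrite /c invfM invrK expRN invrK mulrC.
rewrite -cV.
have := expR_ge1Dx c; rewrite expRN => c1.
have : (expR c)^-1 <= (1 + c)^-1 by rewrite lef_pV2 ?posrE ?expR_gt0// addr_gt0.
have -> : (1 + c^-1)^-1 = 1 - (1 + c)^-1.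
  by field; rewrite !gt_eqF// ?addr_gt0.
lra.
Qed.

(** Jensen's inequality for the sum in [transition_ball_empty_ge], whose mean is bounded by
    [layers_mean_le]. *)
Lemma prob_ball_empty_ge (s K t : R) : 0 <= s -> 0 < K -> 0 < t ->
  3 * t <= K ^+ 2 ->
  ((expR (- (2 * s / t + 6 * K / t)))%:E <=
   \int[P]_w Q t (X 0 w) (ball_empty s))%E.
Proof.
move=> s0 K0 t0 tK.
pose Y w := (\sum_(j <oo)
  ((layer_weight t j)%:E * X 0 w (obal (layer_radius s K j))))%E.
have w0 j w : (0 <= (layer_weight t j)%:E * X 0 w (obal (layer_radius s K j)))%E.
  by rewrite mule_ge0// lee_fin layer_weight_ge0.
have mw j : measurable_fun setT (fun w =>
    ((layer_weight t j)%:E * X 0 w (obal (layer_radius s K j)))%E).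
  exact: measurable_funeM.
have mY : measurable_fun setT Y by exact: ge0_emeasurable_sum.
apply: le_trans (expR_mean_le (Y := Y) mY _ _) _.
- by move=> w; apply: nneseries_ge0.
- rewrite integral_nneseries//.
  apply: le_trans (layers_mean_le s0 t0 (ltW K0)).
  apply: lee_nneseries => [j _ _|j _]; first exact: integral_ge0.
  rewrite ge0_integralZl//; last by rewrite lee_fin layer_weight_ge0.
  have r0 := layer_radius_ge0 j s0 (ltW K0).
  by rewrite (poisson_mean (m := 2 * layer_radius s K j))// ?mulr_ge0//;
    move=> k; exact: X0_obal.
- apply: ge0_le_integral => //.
    by move=> w _; exact: expeR_ge0.
    apply: (measurableT_comp measurable_expeR).
    exact: (@measurableT_comp _ _ _ _ _ _ -%E).
  by move=> w _; exact: transition_ball_empty_ge.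
Qed.

End final_estimates.

(** * The limit as [t] tends to infinity *)

Section limit.
Context {R : realType}.

Let y (t : R) : R := Num.sqrt (Num.sqrt t^-1).

Lemma fourth_rootV_cvg0 : y t @[t --> +oo] --> 0.
Proof.
have h : (t : R)^-1 @[t --> +oo] --> (0 : R).
  apply/gtr0_cvgV0; last exact: cvg_id.
  exact: nbhs_pinfty_gt.
rewrite -[X in _ --> X](@sqrtr0 R) -[X in Num.sqrt X](@sqrtr0 R).
apply: (@continuous_cvg _ _ _ _ _ _ Num.sqrt); first exact: sqrt_continuous.
by apply: (@continuous_cvg _ _ _ _ _ _ Num.sqrt); first exact: sqrt_continuous.
Qed.

Lemma fourth_rootVE (t : R) : 0 < t -> 0 < y t /\ t = y t ^- 4.
Proof.
move=> t0; have tV : 0 < t^-1 by rewrite invr_gt0.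
split; first by rewrite !sqrtr_gt0.
rewrite (exprM _ 2 2) !sqr_sqrtr ?invrK ?sqrtr_ge0// ltW//.
Qed.

(** Multiplying numerator and denominator by [z ^ 4] removes the negative powers, so that the limit
    at [z = 0] follows by continuity. *)
Lemma rescaled_exponentE (r z E : R) : 0 < z -> 0 < E ->
  2 * (r * z ^- 4 - 2 * z ^- 3) / (1 + (1 + z ^- 4) * E) =
  2 * (r - 2 * z) / (z ^+ 4 + (1 + z ^+ 4) * E).
Proof.
move=> z0 E0; have z4 : 0 < z ^+ 4 by rewrite exprn_gt0.
have : 0 < z ^+ 4 + (1 + z ^+ 4) * E by rewrite addr_gt0// mulr_gt0// addr_gt0.
by move=> D0; field; rewrite !gt_eqF.
Qed.

End limit.

Theorem theorem1p1 (R : realType) (p : R) (hp : 1 < p)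
    (d : measure_display) (Omega : measurableType d) (P : probability Omega R)
    (X : R -> Omega -> Mp p)
    (X_sbm : super_brownian_motion P X)
    (X0_prm : poisson_random_measure P lebesgue_measure (X 0))
    (r : R) (hr : 0 < r) :
  P [set w | (r%:E <= empty_radius (X t w) / t%:E)%E] @[t --> +oo%R]
    --> (expR (- (2 * r)))%:E.
Proof.
have p0 : 0 < p by rewrite (lt_trans ltr01).
case: X_sbm => Q hQ hX.
pose y (t : R) : R := Num.sqrt (Num.sqrt t^-1).
have y0 : y t @[t --> +oo] --> 0 := fourth_rootV_cvg0.
(* [lower] and [upper] are the two probability bounds written in terms of [y]; both equal
   [expR (- (2 * r))] at 0. *)
pose lower (z : R) : R := expR (- (2 * r + 12 * z ^+ 2)).
pose upper (z : R) : R := expR (- (2 * (r - 2 * z) /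
  (z ^+ 4 + (1 + z ^+ 4) * expR (2 * z ^+ 2)))).
have yX n : y t ^+ n @[t --> +oo] --> (0 : R) ^+ n.
  by apply: (@continuous_cvg _ _ _ _ _ _ (fun z : R => z ^+ n));
    [exact: exprn_continuous|exact: y0].
have lower0 : lower (y t) @[t --> +oo] --> expR (- (2 * r)).
  have -> : - (2 * r) = - (2 * r + 12 * 0 ^+ 2) :> R by rewrite expr0n mulr0 addr0.
  apply: (@continuous_cvg _ _ _ _ _ _ expR); first exact: continuous_expR.
  apply: cvgN; apply: cvgD; first exact: cvg_cst.
  by apply: cvgM; [exact: cvg_cst|exact: yX].
have upper0 : upper (y t) @[t --> +oo] --> expR (- (2 * r)).
  have -> : - (2 * r) = - (2 * (r - 2 * 0) /
      (0 ^+ 4 + (1 + 0 ^+ 4) * expR (2 * 0 ^+ 2))) :> R.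
    by rewrite !expr0n/= !mulr0 expR0 subr0 addr0 add0r mulr1 divr1.
  apply: (@continuous_cvg _ _ _ _ _ _ expR); first exact: continuous_expR.
  apply: cvgN; apply: cvgM.
    apply: cvgM; first exact: cvg_cst.
    apply: cvgB; first exact: cvg_cst.
    by apply: cvgM; [exact: cvg_cst|exact: y0].
  apply: cvgV; first by rewrite !expr0n/= mulr0 expR0 add0r addr0 mulr1 oner_neq0.
  apply: cvgD; first exact: yX.
  apply: cvgM; first by apply: cvgD; [exact: cvg_cst|exact: yX].
  apply: (@continuous_cvg _ _ _ _ _ _ expR); first exact: continuous_expR.
  by apply: cvgM; [exact: cvg_cst|exact: yX].
apply: (@squeeze_cvge _ _ _ _ (fun t => (lower (y t))%:E) _
  (fun t => (upper (y t))%:E)); last 2 first.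
- by apply: cvg_EFin => //; exact: nearW.
- by apply: cvg_EFin => //; exact: nearW.
(* This ensures [2 * l <= r * t], because [l = y ^ (-3) = t * y]. *)
have yr : \forall t \near +oo, y t < r / 2.
  by apply: (cvgr_lt 0 y0); rewrite divr_gt0.
near=> t.
have t0 : 0 < t by near: t; exact: nbhs_pinfty_gt.
have [yt0 tE] := fourth_rootVE t0; rewrite -/(y t) in yt0 tE.
have yt : y t < r / 2 by near: t.
have rt0 : 0 <= r * t by rewrite mulr_ge0// ltW.
have yn0 : y t != 0 by rewrite gt_eqF.
rewrite (prob_empty_radius hX hr t0).
apply/andP; split.
(* The choice [K = 2 / y ^ 2] has [K ^ 2 = 4 * t >= 3 * t], and the error [6 * K / t = 12 * y ^ 2]
   tends to 0. *)
- have K0 : 0 < 2 / y t ^+ 2 by rewrite divr_gt0// exprn_gt0.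
  have tK : 3 * t <= (2 / y t ^+ 2) ^+ 2.
    have -> : (2 / y t ^+ 2) ^+ 2 = 4 * y t ^- 4 by field.
    by rewrite -tE; lra.
  have := prob_ball_empty_ge p0 hQ X0_prm rt0 K0 t0 tK.
  rewrite (_ : 2 * (r * t) / t + 6 * (2 / y t ^+ 2) / t = 2 * r + 12 * y t ^+ 2)//.
  have -> : 2 * (r * t) / t = 2 * r by field; rewrite gt_eqF.
  congr (_ + _).
  have : 6 * (2 / y t ^+ 2) / y t ^- 4 = 12 * y t ^+ 2 by field.
  by rewrite -tE.
- have l0 : 0 < y t ^- 3 by rewrite invr_gt0 exprn_gt0.
  have tl : y t ^- 3 = t * y t.
    have : y t ^- 3 = y t ^- 4 * y t by field.
    by rewrite -tE.
  have ls : 2 * y t ^- 3 <= r * t by rewrite tl; nra.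
  have := prob_ball_empty_le p0 hQ X0_prm l0 ls t0.
  have -> : 2 * t / (y t ^- 3) ^+ 2 = 2 * y t ^+ 2.
    have : 2 * y t ^- 4 / (y t ^- 3) ^+ 2 = 2 * y t ^+ 2 by field.
    by rewrite -tE.
  rewrite /upper -(@rescaled_exponentE _ r _ (expR (2 * y t ^+ 2)) yt0) ?expR_gt0//.
  by rewrite -tE.
Unshelve. all: by end_near. Qed.
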